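(* Let $G$ be a finite group and let $H$ be a Schur cover of $G$, with $H/M=G$ where $M\leq H'\cap Z(H)$ is isomorphic to the Schur multiplier of $G$. Suppose that $G$ has an AI-automorphism that lifts to an AI-automorphism $\alpha$ of $H$ which inverts $M$, that is, $\alpha(m)=m^{-1}$ for all $m\in M$. Then: a) $\tilde K(G,3)\cong\tau(G)$. b) $\tilde K(G,3)\cong T(H)/T(M)$.
   Context: Conventions: $[g,h]=g^{-1}h^{-1}gh$, $g^h=h^{-1}gh$, and $G'$ is the commutator subgroup. Let $G^\ast$ be an isomorphic copy of $G$ via $g\mapsto g^\ast$, and let $G\star G^\ast$ be the free product. The group $\nu(G)$ is the quotient of $G\star G^\ast$ by the normal closure of all elements $[x,y^\ast]^z[x^z,(y^z)^\ast]^{-1}$ and $[x,y^\ast]^{(z^\ast)}[x^z,(y^z)^\ast]^{-1}$ with $x,y,z\in G$. Put $\nabla(G)=\langle [x,x^\ast]: x\in G\rangle\leq \nu(G)$ and $\tau(G)=\nu(G)/\nabla(G)$. For any group $X$ and $n\geq 2$, $K(X,n)=\{(g_1,\ldots,g_n)\in X^n: g_1\cdots g_n\in X'\}$. For a free presentation $G=F/N$ with $F$ free of finite rank, $\tilde K(G,n)=K(F,n)/K(N,n)^{F^n}$, where $K(N,n)^{F^n}$ is the normal closure of $K(N,n)$ in $F^n$; up to isomorphism this does not depend on the presentation. For any group $X$, $T(X)=\{(g,h,cgh): g,h\in X,\ c\in X'\}$ is the kernel of the homomorphism $X^3\to X/X'$, $(g,h,k)\mapsto ghk^{-1}X'$.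 A Schur cover of $G$ is a group $H$ such that $H/M\cong G$ for some $M\leq H'\cap Z(H)$ isomorphic to the Schur multiplier $M(G)=H^2(G,\mathbb{C}^\times)\cong H_2(G,\mathbb{Z})$. An AI-automorphism of a group is an automorphism that induces the inversion automorphism on its abelianisation. *)

(* Defs.v *)
From HB Require Import structures.
From mathcomp Require Import all_boot ssralg fingroup generic_quotient.
From mathcomp Require Import boolp reals complex.

Set Implicit Arguments.
Unset Strict Implicit.
Unset Printing Implicit Defensive.

Local Open Scope group_scope.
Local Open Scope quotient_scope.

(* Groups are [groupType]s (not necessarily finite) and subgroups are
   [groupClosed] predicates.  The library conventions
   [~ x, y] = x^-1 * (y^-1 * (x * y)) and x ^ y = y^-1 * (x * y) are used. *)

Definition fullg (X : groupType) : {pred X} := predT.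

Section Full.
Variable X : groupType.
Fact fullg_mul : mulg_closed (@fullg X). Proof. by []. Qed.
Fact fullg_one : 1 \in @fullg X. Proof. by []. Qed.
Fact fullg_inv : invg_closed (@fullg X). Proof. by []. Qed.
HB.instance Definition _ := isMulClosed.Build X (@fullg X) fullg_mul.
HB.instance Definition _ := isMul1Closed.Build X (@fullg X) fullg_one.
HB.instance Definition _ := isInvClosed.Build X (@fullg X) fullg_inv.
End Full.
Arguments fullg X : clear implicits.

Definition sgroup (X : groupType) (S : groupClosed X) := {x : X | x \in S}.

Section SGroup.
Variables (X : groupType) (S : groupClosed X).
HB.instance Definition _ := SubChoice.on (sgroup S).
Fact sgroup_closed : group_closed S.
Proof. by split; [exact: gpred1 | move=> x y; exact: gpredF]. Qed.
HB.instance Definition _ :=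
  SubChoice_isSubGroup.Build X (fun x => x \in S) (sgroup S) sgroup_closed.
End SGroup.

Notation "{ 'hom' X -> Y }" := (UMagmaMorphism.type X Y)
  (at level 0, X at level 98, Y at level 99, format "{ 'hom'  X  ->  Y }")
  : type_scope.

Definition isog (X Y : groupType) : Prop :=
  exists f : {hom X -> Y}, bijective f.

Definition normalp (X : groupType) (N : {pred X}) : Prop :=
  forall x y, x \in N -> x ^ y \in N.

Definition center (X : groupType) : {pred X} :=
  fun x => `[< forall y, commute x y >].
Arguments center X : clear implicits.

Definition gen (X : groupType) (A : {pred X}) : {pred X} :=
  fun x => `[< forall S : groupClosed X, {subset A <= S} -> x \in S >].

Definition ncl (X : groupType) (A : {pred X}) : {pred X} :=
  fun x => `[< forall N : groupClosed X,
                 normalp N -> {subset A <= N} -> x \in N >].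

Section Generated.
Variables (X : groupType) (A : {pred X}).

Fact gen_mul : mulg_closed (gen A).
Proof.
move=> x y /asboolP Hx /asboolP Hy; apply/asboolP => S sAS.
by rewrite gpredM ?Hx ?Hy.
Qed.
Fact gen_one : 1 \in gen A.
Proof. by apply/asboolP => S _; exact: gpred1. Qed.
Fact gen_inv : invg_closed (gen A).
Proof. by move=> x /asboolP Hx; apply/asboolP => S sAS; rewrite gpredV Hx. Qed.
HB.instance Definition _ := isMulClosed.Build X (gen A) gen_mul.
HB.instance Definition _ := isMul1Closed.Build X (gen A) gen_one.
HB.instance Definition _ := isInvClosed.Build X (gen A) gen_inv.

Fact ncl_mul : mulg_closed (ncl A).
Proof.
move=> x y /asboolP Hx /asboolP Hy; apply/asboolP => S nS sAS.
by rewrite gpredM ?Hx ?Hy.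
Qed.
Fact ncl_one : 1 \in ncl A.
Proof. by apply/asboolP => S _ _; exact: gpred1. Qed.
Fact ncl_inv : invg_closed (ncl A).
Proof.
by move=> x /asboolP Hx; apply/asboolP => S nS sAS; rewrite gpredV Hx.
Qed.
HB.instance Definition _ := isMulClosed.Build X (ncl A) ncl_mul.
HB.instance Definition _ := isMul1Closed.Build X (ncl A) ncl_one.
HB.instance Definition _ := isInvClosed.Build X (ncl A) ncl_inv.

Lemma mem_gen : {subset A <= gen A}.
Proof. by move=> x Ax; apply/asboolP => S; exact. Qed.

Lemma gen_sub (S : groupClosed X) : {subset A <= S} -> {subset gen A <= S}.
Proof. by move=> sAS x /asboolP; exact. Qed.

Lemma mem_ncl : {subset A <= ncl A}.
Proof. by move=> x Ax; apply/asboolP => S _; exact. Qed.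

Lemma ncl_sub (N : groupClosed X) :
  normalp N -> {subset A <= N} -> {subset ncl A <= N}.
Proof. by move=> nN sAN x /asboolP; exact. Qed.

Lemma ncl_normal : normalp (ncl A).
Proof.
by move=> x y /asboolP Hx; apply/asboolP => N nN sAN; apply/nN/Hx.
Qed.

End Generated.

Lemma ncl_id (X : groupType) (N : groupClosed X) : normalp N -> ncl N =i N.
Proof.
move=> nN x; apply/idP/idP; last exact: mem_ncl.
exact: (ncl_sub nN).
Qed.

(* [quot A] is X modulo the normal closure of A.  When A is a normal subgroup
   this is the quotient X / A (see [ncl_id] and [piqE]). *)
Section Quotient.
Variables (X : groupType) (A : {pred X}).

Definition quot_rel (x y : X) : bool := x^-1 * y \in ncl A.

Fact quot_rel_refl : reflexive quot_rel.
Proof. by move=> x; rewrite /quot_rel mulVg gpred1. Qed.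
Fact quot_rel_sym : symmetric quot_rel.
Proof. by move=> x y; rewrite /quot_rel -[in RHS]gpredV invgM invgK. Qed.
Fact quot_rel_trans : transitive quot_rel.
Proof.
move=> y x z Hxy Hyz; rewrite /quot_rel.
by rewrite -(mulgK y x^-1) -mulgA gpredM // mulgA.
Qed.
Canonical quot_equiv := EquivRel quot_rel
  quot_rel_refl quot_rel_sym quot_rel_trans.

Definition quot := {eq_quot quot_equiv}.
HB.instance Definition _ := Choice.on quot.
HB.instance Definition _ := EqQuotient.on quot.

Definition piq (x : X) : quot := \pi_quot x.

Lemma piqP x y : reflect (piq x = piq y) (x^-1 * y \in ncl A).
Proof. by rewrite -/(quot_rel x y) -(@pi_eq_quot _ _ quot); exact: eqP. Qed.

Lemma reprqK q : piq (repr q) = q. Proof. exact: reprK. Qed.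

Definition quot_one : quot := piq 1.
Definition quot_mul (p q : quot) : quot := piq (repr p * repr q).
Definition quot_inv (p : quot) : quot := piq (repr p)^-1.

Lemma quot_mulE x y : quot_mul (piq x) (piq y) = piq (x * y).
Proof.
apply/piqP; set a := repr _; set b := repr _.
have /piqP Ha : piq a = piq x by exact: reprqK.
have /piqP Hb : piq b = piq y by exact: reprqK.
have -> : (a * b)^-1 * (x * y) = (a^-1 * x) ^ b * (b^-1 * y).
  by rewrite conjgE invgM !mulgA !mulgK.
by rewrite gpredM // ncl_normal.
Qed.

Lemma quot_invE x : quot_inv (piq x) = piq x^-1.
Proof.
apply/piqP; set a := repr _.
have /piqP Ha : piq a = piq x by exact: reprqK.
have -> : a^-1^-1 * x^-1 = (a^-1 * x)^-1 ^ a^-1.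
  by rewrite conjgE invgM !invgK !mulgA mulgK.
by rewrite ncl_normal // gpredV.
Qed.

Fact quot_mulA : associative quot_mul.
Proof.
move=> p q r; rewrite -(reprqK p) -(reprqK q) -(reprqK r).
by rewrite !quot_mulE mulgA.
Qed.
Fact quot_mul1 : left_id quot_one quot_mul.
Proof. by move=> p; rewrite -(reprqK p) quot_mulE mul1g. Qed.
Fact quot_mulr1 : right_id quot_one quot_mul.
Proof. by move=> p; rewrite -(reprqK p) quot_mulE mulg1. Qed.
Fact quot_mulV : left_inverse quot_one quot_inv quot_mul.
Proof. by move=> p; rewrite -(reprqK p) quot_invE quot_mulE mulVg. Qed.
Fact quot_mulrV : right_inverse quot_one quot_inv quot_mul.
Proof. by move=> p; rewrite -(reprqK p) quot_invE quot_mulE mulgV. Qed.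

HB.instance Definition _ := isGroup.Build quot
  quot_mulA quot_mul1 quot_mulr1 quot_mulV quot_mulrV.

Fact piqM : {morph piq : x y / x * y}.
Proof. by move=> x y; exact/esym/quot_mulE. Qed.
HB.instance Definition _ :=
  isUMagmaMorphism.Build X quot piq (erefl, piqM).

Lemma piqE x : (piq x = 1) <-> (x \in ncl A).
Proof. by rewrite -[x \in _]gpredV -[x^-1]mulg1; split => /piqP. Qed.

End Quotient.

Arguments piq {X} A x.

(* For A a normal subgroup of X contained in S, [sect S A] is S / A: A is first
   viewed inside the group [sgroup S] (see [restr_normal]). *)
Definition restr (X : groupType) (S : groupClosed X) (A : {pred X}) :
  {pred sgroup S} := fun u => val u \in A.
Definition sect (X : groupType) (S : groupClosed X) (A : {pred X}) :=
  quot (restr (S := S) A).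
HB.instance Definition _ X S A := Group.on (@sect X S A).

Definition comms (X : groupType) (S : {pred X}) : {pred X} :=
  fun z => `[< exists x y, [/\ x \in S, y \in S & z = [~ x, y]] >].
Definition der (X : groupType) (S : {pred X}) : {pred X} := gen (comms S).
HB.instance Definition _ (X : groupType) (S : {pred X}) :=
  GroupClosed.on (der S).

Lemma der_sub (X : groupType) (S : groupClosed X) : {subset der S <= S}.
Proof.
by apply: gen_sub => _ /asboolP[x [y [Sx Sy ->]]]; exact: gpredR.
Qed.

Definition conj_pred (X : groupType) (A : {pred X}) (y : X) : {pred X} :=
  fun x => x ^ y \in A.
Section ConjPred.
Variables (X : groupType) (A : groupClosed X) (y : X).
Fact conj_pred_mul : mulg_closed (conj_pred A y).
Proof. by move=> u v Hu Hv; rewrite unfold_in conjMg gpredM. Qed.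
Fact conj_pred_one : 1 \in conj_pred A y.
Proof. by rewrite unfold_in conj1g gpred1. Qed.
Fact conj_pred_inv : invg_closed (conj_pred A y).
Proof. by move=> u Hu; rewrite unfold_in conjVg gpredV. Qed.
HB.instance Definition _ := isMulClosed.Build X (conj_pred A y) conj_pred_mul.
HB.instance Definition _ := isMul1Closed.Build X (conj_pred A y) conj_pred_one.
HB.instance Definition _ := isInvClosed.Build X (conj_pred A y) conj_pred_inv.
End ConjPred.

Lemma gen_conj (X : groupType) (A : {pred X}) y :
  (forall x, x \in A -> x ^ y \in gen A) ->
  forall x, x \in gen A -> x ^ y \in gen A.
Proof. by move=> H x; apply: (gen_sub (S := conj_pred (gen A) y)). Qed.

Lemma derJ (X : groupType) (S : groupClosed X) x y :
  y \in S -> x \in der S -> x ^ y \in der S.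
Proof.
move=> Sy; apply: gen_conj => _ /asboolP[a [b [Sa Sb ->]]].
apply/mem_gen/asboolP; exists (a ^ y), (b ^ y).
by rewrite conjRg !gpredJ.
Qed.

Lemma der_normal (X : groupType) : normalp (der (fullg X)).
Proof. by move=> x y; exact: derJ. Qed.

(* Abelianisation; the denominator is normal by [der_normal]. *)
Definition abel (X : groupType) := quot (der (fullg X)).
HB.instance Definition _ X := Group.on (abel X).
Definition pi_ab (X : groupType) (x : X) : abel X := piq (der (fullg X)) x.

Definition AI_automorphism (X : groupType) (f : {hom X -> X}) :=
  bijective f /\ forall x, pi_ab (f x) = (pi_ab x)^-1.

(* The free product of G1 and G2: words with letters in the disjoint union of
   G1 and G2, modulo the congruence generated by multiplication of adjacent
   letters of the same factor and deletion of the trivial letters. *)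
Section FreeProduct.
Variables G1 G2 : groupType.
Implicit Types v w : seq (G1 + G2).

Inductive fp_cong : seq (G1 + G2) -> seq (G1 + G2) -> Prop :=
| FPrefl w : fp_cong w w
| FPsym v w : fp_cong v w -> fp_cong w v
| FPtrans u v w : fp_cong u v -> fp_cong v w -> fp_cong u w
| FPcat v v' w w' : fp_cong v v' -> fp_cong w w' -> fp_cong (v ++ w) (v' ++ w')
| FPone1 : fp_cong [:: inl 1] [::]
| FPone2 : fp_cong [:: inr 1] [::]
| FPmul1 (x y : G1) : fp_cong [:: inl x; inl y] [:: inl (x * y)]
| FPmul2 (x y : G2) : fp_cong [:: inr x; inr y] [:: inr (x * y)].

Definition fp_rel v w : bool := `[< fp_cong v w >].
Fact fp_rel_refl : reflexive fp_rel.
Proof. by move=> w; exact/asboolP/FPrefl. Qed.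
Fact fp_rel_sym : symmetric fp_rel.
Proof. by move=> v w; apply/asboolP/asboolP; exact: FPsym. Qed.
Fact fp_rel_trans : transitive fp_rel.
Proof.
by move=> v u w /asboolP Huv /asboolP Hvw; exact/asboolP/(FPtrans Huv).
Qed.
Canonical fp_equiv := EquivRel fp_rel fp_rel_refl fp_rel_sym fp_rel_trans.

Definition fprod := {eq_quot fp_equiv}.
HB.instance Definition _ := Choice.on fprod.
HB.instance Definition _ := EqQuotient.on fprod.

Definition fp_pi w : fprod := \pi_fprod w.

Lemma fp_piP v w : fp_pi v = fp_pi w <-> fp_cong v w.
Proof.
split=> [/eqP|Hvw]; first by rewrite pi_eq_quot => /asboolP.
by apply/eqP; rewrite pi_eq_quot; exact/asboolP.
Qed.

Lemma fp_reprK p : fp_pi (repr p) = p. Proof. exact: reprK. Qed.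

Definition fp_inv_letter (a : G1 + G2) : G1 + G2 :=
  match a with inl x => inl x^-1 | inr y => inr y^-1 end.
Definition fp_inv_word w := rev (map fp_inv_letter w).

Definition fp_one : fprod := fp_pi [::].
Definition fp_mul (p q : fprod) : fprod := fp_pi (repr p ++ repr q).
Definition fp_inv (p : fprod) : fprod := fp_pi (fp_inv_word (repr p)).

Lemma fp_mulE v w : fp_mul (fp_pi v) (fp_pi w) = fp_pi (v ++ w).
Proof. by apply/fp_piP/FPcat; apply/fp_piP; rewrite fp_reprK. Qed.

Lemma fp_inv_cong v w : fp_cong v w -> fp_cong (fp_inv_word v) (fp_inv_word w).
Proof.
rewrite /fp_inv_word.
elim=> {v w} [w|v w _ IH|u v w _ IH1 _ IH2|v v' w w' _ IH1 _ IH2||||].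
- exact: FPrefl.
- exact: FPsym.
- exact: FPtrans IH1 IH2.
- by rewrite !map_cat !rev_cat; exact: FPcat.
- by rewrite /= invg1; exact: FPone1.
- by rewrite /= invg1; exact: FPone2.
- by move=> x y; rewrite /= invgM; exact: FPmul1.
- by move=> x y; rewrite /= invgM; exact: FPmul2.
Qed.

Lemma fp_invE w : fp_inv (fp_pi w) = fp_pi (fp_inv_word w).
Proof. by apply/fp_piP/fp_inv_cong/fp_piP; rewrite fp_reprK. Qed.

Lemma fp_inv_wordK : involutive fp_inv_word.
Proof.
move=> w; rewrite /fp_inv_word map_rev revK -map_comp map_id_in //.
by case=> x _ /=; rewrite invgK.
Qed.

Lemma fp_word_invr w : fp_cong (w ++ fp_inv_word w) [::].
Proof.
elim: w => [|a w IH]; first exact: FPrefl.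
rewrite /fp_inv_word /= rev_cons -cats1 catA -/(fp_inv_word w).
apply: (@FPtrans _ ([:: a] ++ [:: fp_inv_letter a])).
  apply: (@FPcat [:: a & w ++ _] [:: a]); last exact: FPrefl.
  by apply: (@FPcat [:: a] [:: a] _ [::]); first exact: FPrefl.
case: a => x /=.
  by apply: FPtrans (FPmul1 _ _) _; rewrite mulgV; exact: FPone1.
by apply: FPtrans (FPmul2 _ _) _; rewrite mulgV; exact: FPone2.
Qed.

Fact fp_mulA : associative fp_mul.
Proof.
move=> p q r; rewrite -(fp_reprK p) -(fp_reprK q) -(fp_reprK r).
by rewrite !fp_mulE catA.
Qed.
Fact fp_mul1 : left_id fp_one fp_mul.
Proof. by move=> p; rewrite -(fp_reprK p) fp_mulE. Qed.
Fact fp_mulr1 : right_id fp_one fp_mul.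
Proof. by move=> p; rewrite -(fp_reprK p) fp_mulE cats0. Qed.
Fact fp_mulrV : right_inverse fp_one fp_inv fp_mul.
Proof.
move=> p; rewrite -(fp_reprK p) fp_invE fp_mulE.
exact/fp_piP/fp_word_invr.
Qed.
Fact fp_mulV : left_inverse fp_one fp_inv fp_mul.
Proof.
move=> p; rewrite -(fp_reprK p) fp_invE fp_mulE; apply/fp_piP.
by have := fp_word_invr (fp_inv_word (repr p)); rewrite fp_inv_wordK.
Qed.

HB.instance Definition _ := isGroup.Build fprod
  fp_mulA fp_mul1 fp_mulr1 fp_mulV fp_mulrV.

Definition fp_inl (x : G1) : fprod := fp_pi [:: inl x].
Definition fp_inr (y : G2) : fprod := fp_pi [:: inr y].

Fact fp_inlM : {morph fp_inl : x y / x * y}.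
Proof.
move=> x y; rewrite [RHS]fp_mulE; exact/esym/fp_piP/FPmul1.
Qed.
Fact fp_inl1 : fp_inl 1 = 1.
Proof. exact/fp_piP/FPone1. Qed.
HB.instance Definition _ :=
  isUMagmaMorphism.Build G1 fprod fp_inl (fp_inl1, fp_inlM).
Fact fp_inrM : {morph fp_inr : x y / x * y}.
Proof.
move=> x y; rewrite [RHS]fp_mulE; exact/esym/fp_piP/FPmul2.
Qed.
Fact fp_inr1 : fp_inr 1 = 1.
Proof. exact/fp_piP/FPone2. Qed.
HB.instance Definition _ :=
  isUMagmaMorphism.Build G2 fprod fp_inr (fp_inr1, fp_inrM).

Lemma fprod_ind (P : fprod -> Prop) :
  P 1 -> (forall x p, P p -> P (fp_inl x * p)) ->
  (forall y p, P p -> P (fp_inr y * p)) -> forall p, P p.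
Proof.
move=> P1 Pl Pr p; rewrite -(fp_reprK p); elim: (repr p) => [|[x|y] w IH] //.
  by have := Pl x _ IH; rewrite [_ * _]fp_mulE.
by have := Pr y _ IH; rewrite [_ * _]fp_mulE.
Qed.

End FreeProduct.

(* The isomorphic copy of G is the second factor of [fprod G G], with
   g* = fp_inr g. *)
Section Nu.
Variable G : groupType.
Local Notation i := (@fp_inl G G).
Local Notation j := (@fp_inr G G).

Definition nu_relators : {pred fprod G G} := fun u =>
  `[< exists x y z : G,
        u = [~ i x, j y] ^ i z * [~ i (x ^ z), j (y ^ z)]^-1 \/
        u = [~ i x, j y] ^ j z * [~ i (x ^ z), j (y ^ z)]^-1 >].

Definition nu := quot nu_relators.
HB.instance Definition _ := Group.on nu.

Definition nu_in (g : G) : nu := piq nu_relators (i g).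
Definition nu_star (g : G) : nu := piq nu_relators (j g).

Definition nabla_gens : {pred nu} :=
  fun u => `[< exists x : G, u = [~ nu_in x, nu_star x] >].
Definition nabla : {pred nu} := gen nabla_gens.
HB.instance Definition _ := GroupClosed.on nabla.

Lemma nu_relE x y z :
  [~ nu_in x, nu_star y] ^ nu_in z = [~ nu_in (x ^ z), nu_star (y ^ z)] /\
  [~ nu_in x, nu_star y] ^ nu_star z = [~ nu_in (x ^ z), nu_star (y ^ z)].
Proof.
have E (u v : fprod G G) : u * v^-1 \in nu_relators ->
    piq nu_relators u = piq nu_relators v.
  by move=> H; apply/divg1_eq; rewrite -gmulfF; apply/piqE/mem_ncl.
split.
  have := E ([~ i x, j y] ^ i z) [~ i (x ^ z), j (y ^ z)].
  rewrite (gmulfJ (piq _)) !(gmulfR (piq _)); apply.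
  by apply/asboolP; exists x, y, z; left.
have := E ([~ i x, j y] ^ j z) [~ i (x ^ z), j (y ^ z)].
rewrite (gmulfJ (piq _)) !(gmulfR (piq _)); apply.
by apply/asboolP; exists x, y, z; right.
Qed.

Lemma nabla_normal : normalp nabla.
Proof.
suff H p u : u \in nabla -> u ^ piq nu_relators p \in nabla.
  by move=> u y; rewrite -(reprqK y); exact: H.
elim/fprod_ind: p u => [u|x p IH u|x p IH u] Hu.
- by rewrite gmulf1 conjg1.
- rewrite gmulfM conjgM; apply: IH; apply: gen_conj Hu => _ /asboolP[a ->].
  by apply/mem_gen/asboolP; exists (a ^ x); case: (nu_relE a a x).
- rewrite gmulfM conjgM; apply: IH; apply: gen_conj Hu => _ /asboolP[a ->].
  by apply/mem_gen/asboolP; exists (a ^ x); case: (nu_relE a a x).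
Qed.

(* The denominator is normal by [nabla_normal]. *)
Definition tau := quot nabla.
HB.instance Definition _ := Group.on tau.

End Nu.

(* The sets K(S, n) and T(S), for a subgroup S of X, as subsets of X^n and
   X^3.  The product g_1 ... g_n is taken in increasing order of indices. *)
Definition Kset (X : groupType) (S : {pred X}) (n : nat) :
    {pred {ffun 'I_n -> X}} := fun g =>
  `[< (forall k, g k \in S) /\ \prod_(k < n) g k \in der S >].
Arguments Kset {X} S n _.

Definition Tset (X : groupType) (S : {pred X}) : {pred X * X * X} := fun u =>
  `[< exists g h c, [/\ g \in S, h \in S, c \in der S &
                        u = (g, h, c * g * h)] >].

Section KT.
Variables (X : groupType) (S : groupClosed X) (n : nat).

Let eqd (x y : X) := x^-1 * y \in der S.

Let eqdM x x' y y' : x \in S -> y \in S -> x' \in S -> y' \in S ->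
  eqd x x' -> eqd y y' -> eqd (x * y) (x' * y').
Proof.
move=> Sx Sy Sx' Sy' Hx Hy; rewrite /eqd.
have -> : (x * y)^-1 * (x' * y') = (x^-1 * x') ^ y * (y^-1 * y').
  by rewrite conjgE invgM !mulgA !mulgK.
by rewrite gpredM // derJ.
Qed.

Let eqd_comm x y : x \in S -> y \in S -> eqd (x * y) (y * x).
Proof.
move=> Sx Sy; rewrite /eqd invgM -mulgA -/(commg y x).
by apply/mem_gen/asboolP; exists y, x.
Qed.

Let eqd_mem x y : eqd x y -> x \in der S -> y \in der S.
Proof. by move=> Hxy Hx; rewrite -(mulKg x^-1 y) invgK gpredM. Qed.

Let eqd_refl x : eqd x x. Proof. by rewrite /eqd mulVg gpred1. Qed.
Let eqd_trans x y z : eqd x y -> eqd y z -> eqd x z.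
Proof.
move=> Hxy Hyz; rewrite /eqd.
by rewrite -(mulgK y x^-1) -mulgA gpredM // mulgA.
Qed.
Let eqd_sym x y : eqd x y -> eqd y x.
Proof. by rewrite /eqd -[in X in _ -> X]gpredV invgM invgK. Qed.

Let swap4 a b c d : a \in S -> b \in S -> c \in S -> d \in S ->
  eqd (a * b * (c * d)) (a * c * (b * d)).
Proof.
move=> Sa Sb Sc Sd; rewrite -!mulgA (mulgA b) (mulgA c).
apply: eqdM; rewrite ?gpredM //.
by apply: eqdM; rewrite ?gpredM //; exact: eqd_comm.
Qed.

Fact Kset_mul : mulg_closed (Kset S n).
Proof.
move=> f g /asboolP[Sf Hf] /asboolP[Sg Hg]; apply/asboolP; split=> [k|].
  by rewrite ffunE gpredM.
apply: eqd_mem (gpredM _ _ Hf Hg).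
suff: [/\ eqd (\prod_(k < n) f k * \prod_(k < n) g k) (\prod_(k < n) (f * g) k),
          \prod_(k < n) f k \in S, \prod_(k < n) g k \in S &
          \prod_(k < n) (f * g) k \in S] by case.
elim/big_ind3: _ => [|a b c a' b' c' [H Sa Sb Sc] [H' Sa' Sb' Sc']|k _].
- by rewrite mulg1 gpred1 eqd_refl.
- split; rewrite ?gpredM //; apply: eqd_trans (swap4 _ _ _ _) _ => //.
  by apply: eqdM; rewrite ?gpredM.
- by rewrite ffunE eqd_refl gpredM.
Qed.
Fact Kset_one : 1 \in Kset S n.
Proof.
apply/asboolP; split=> [k|]; first by rewrite ffunE gpred1.
by apply: gpred_prod => k _; rewrite ffunE gpred1.
Qed.
Fact Kset_inv : invg_closed (Kset S n).
Proof.
move=> f /asboolP[Sf Hf]; apply/asboolP; split=> [k|].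
  by rewrite ffunE gpredV.
have Hf' : (\prod_(k < n) f k)^-1 \in der S by rewrite gpredV.
apply: eqd_mem Hf'.
suff: [/\ eqd (\prod_(k < n) f k)^-1 (\prod_(k < n) f^-1 k),
          \prod_(k < n) f k \in S & \prod_(k < n) f^-1 k \in S] by case.
elim/big_ind2: _ => [|a b a' b' [H Sa Sb] [H' Sa' Sb']|k _].
- by rewrite invg1 eqd_refl gpred1.
- split; rewrite ?gpredM // invgM.
  apply: eqd_trans (eqd_comm _ _) _; rewrite ?gpredV //.
  by apply: eqdM; rewrite ?gpredV.
- by rewrite ffunE eqd_refl gpredV Sf.
Qed.
HB.instance Definition _ :=
  isMulClosed.Build {ffun 'I_n -> X} (Kset S n) Kset_mul.
HB.instance Definition _ :=
  isMul1Closed.Build {ffun 'I_n -> X} (Kset S n) Kset_one.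
HB.instance Definition _ :=
  isInvClosed.Build {ffun 'I_n -> X} (Kset S n) Kset_inv.

Lemma TsetP u : reflect
  [/\ u.1.1 \in S, u.1.2 \in S, u.2 \in S & eqd u.2 (u.1.1 * u.1.2)]
  (u \in Tset S).
Proof.
apply: (iffP (asboolP _)) => [[g [h [c [Sg Sh Hc ->]]]]|].
  have Sc := der_sub Hc; rewrite /= !gpredM //; split=> //.
  rewrite /eqd; have -> : (c * g * h)^-1 * (g * h) = c^-1 ^ (g * h).
    by rewrite -(mulgA c) invgM conjgE -[LHS]mulgA.
  by rewrite derJ ?gpredM // gpredV.
case: u => [[g h] k] /= [Sg Sh Sk Hk].
exists g, h, (k * (g * h)^-1); split=> //; last first.
  by rewrite -[_ * g * h]mulgA mulgVK.
have Hk' : (g * h)^-1 * k \in der S by exact: eqd_sym.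
have -> : k * (g * h)^-1 = ((g * h)^-1 * k) ^ (g * h)^-1.
  by rewrite conjgE invgK mulgA mulVKg.
by apply: derJ => //; rewrite gpredV gpredM.
Qed.

Fact Tset_mul : mulg_closed (Tset S).
Proof.
move=> u v /TsetP[H1 H2 H3 H4] /TsetP[H1' H2' H3' H4']; apply/TsetP => /=.
split; rewrite ?gpredM //.
apply: eqd_trans (eqdM _ _ _ _ H4 H4') _; rewrite ?gpredM //.
exact: swap4.
Qed.
Fact Tset_one : 1 \in Tset S.
Proof. by apply/TsetP; rewrite /= mulg1 eqd_refl gpred1. Qed.
Fact Tset_inv : invg_closed (Tset S).
Proof.
move=> u /TsetP[H1 H2 H3 H4]; apply/TsetP => /=; rewrite !gpredV; split=> //.
have Hs := eqd_comm H1 H2.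
have := eqd_trans H4 Hs; rewrite /eqd => H5.
have -> : u.2^-1^-1 * (u.1.1^-1 * u.1.2^-1)
          = ((u.2^-1 * (u.1.2 * u.1.1))^-1) ^ u.2^-1.
  by rewrite conjgE invgK !invgM !invgK !mulgA mulgK.
by rewrite derJ ?gpredV.
Qed.
HB.instance Definition _ := isMulClosed.Build (X * X * X)%type (Tset S) Tset_mul.
HB.instance Definition _ :=
  isMul1Closed.Build (X * X * X)%type (Tset S) Tset_one.
HB.instance Definition _ := isInvClosed.Build (X * X * X)%type (Tset S) Tset_inv.

End KT.

Definition free_basis (F : groupType) (r : nat) (b : 'I_r -> F) : Prop :=
  forall (Y : groupType) (y : 'I_r -> Y),
    exists f : {hom F -> Y},
      (forall k, f (b k) = y k) /\
      forall f' : {hom F -> Y}, (forall k, f' (b k) = y k) -> f' =1 f.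

Definition free_presentation (F : groupType) (N : groupClosed F)
    (G : groupType) : Prop :=
  [/\ exists r (b : 'I_r -> F), free_basis b,
      normalp N & isog (quot N) G].

(* K(F, n) / K(N, n)^(F^n), for a presentation G = F / N; the denominator is
   contained in the numerator by [Ktilde_denom]. *)
Definition Ktilde (F : groupType) (N : groupClosed F) (n : nat) :=
  sect (Kset (fullg F) n) (ncl (Kset N n)).
HB.instance Definition _ F N n := Group.on (@Ktilde F N n).

Lemma Ktilde_denom (F : groupType) (N : groupClosed F) (n : nat) :
  {subset ncl (Kset N n) <= Kset (fullg F) n}.
Proof.
apply: ncl_sub => [f g Hf|f /asboolP[_ Hf]]; last first.
  apply/asboolP; split=> //; apply: gen_sub Hf => _ /asboolP[x [y [_ _ ->]]].
  by apply/mem_gen/asboolP; exists x, y.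
have -> : f ^ g = f * [~ f, g] by rewrite commgEl mulVKg.
rewrite gpredM //; apply/asboolP; split=> //.
apply: gpred_prod => k _; rewrite !ffunE.
by apply/mem_gen/asboolP; exists (f k), (g k).
Qed.

(* T(H) / T(M); for M central in H the denominator is normal in H^3, by
   [Tset_normal]. *)
Definition TquotT (H : groupType) (M : groupClosed H) :=
  sect (Tset (fullg H)) (Tset M).
HB.instance Definition _ H M := Group.on (@TquotT H M).

Lemma Tset_normal (H : groupType) (M : groupClosed H) :
  {subset M <= center H} -> normalp (Tset M).
Proof.
move=> cM u v Hu; suff -> : u ^ v = u by [].
have cE x y : x \in M -> y^-1 * (x * y) = x.
  by move=> /cM/asboolP ->; rewrite mulKg.
have /TsetP[H1 H2 H3 _] := Hu.
by case: u v {Hu} H1 H2 H3 => [[a b] c] [[a' b'] c'] /= *;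
  congr (_, _, _); exact: cE.
Qed.

Lemma restr_normal (X : groupType) (S : groupClosed X) (A : {pred X}) :
  normalp A -> normalp (restr (S := S) A).
Proof. by move=> nA u v Hu; rewrite unfold_in gmulfJ; exact: nA. Qed.

Definition mgroup (K : fieldType) := {x : K | x != 0%R}.

Section MGroup.
Variable K : fieldType.
Import GRing.Theory.
Local Notation U := (mgroup K).
HB.instance Definition _ := SubChoice.on U.
Fact mgroup_mul_subproof (x y : U) : (val x * val y)%R != 0%R.
Proof. by rewrite mulf_neq0 // (valP x, valP y). Qed.
Fact mgroup_inv_subproof (x : U) : (val x)^-1%R != 0%R.
Proof. by rewrite invr_neq0 // (valP x). Qed.
Definition mgroup_one : U := exist _ 1%R (oner_neq0 K).
Definition mgroup_mul (x y : U) : U :=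
  exist _ (val x * val y)%R (mgroup_mul_subproof x y).
Definition mgroup_inv (x : U) : U :=
  exist _ (val x)^-1%R (mgroup_inv_subproof x).
Fact mgroup_mulA : associative mgroup_mul.
Proof. by move=> x y z; apply/val_inj; rewrite /= mulrA. Qed.
Fact mgroup_mulC : commutative mgroup_mul.
Proof. by move=> x y; apply/val_inj; rewrite /= mulrC. Qed.
Fact mgroup_mul1 : left_id mgroup_one mgroup_mul.
Proof. by move=> x; apply/val_inj; rewrite /= mul1r. Qed.
Fact mgroup_mulr1 : right_id mgroup_one mgroup_mul.
Proof. by move=> x; rewrite mgroup_mulC mgroup_mul1. Qed.
Fact mgroup_mulV : left_inverse mgroup_one mgroup_inv mgroup_mul.
Proof. by move=> x; apply/val_inj; rewrite /= mulVf // (valP x). Qed.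
Fact mgroup_mulrV : right_inverse mgroup_one mgroup_inv mgroup_mul.
Proof. by move=> x; rewrite mgroup_mulC mgroup_mulV. Qed.
HB.instance Definition _ := isGroup.Build U
  mgroup_mulA mgroup_mul1 mgroup_mulr1 mgroup_mulV mgroup_mulrV.
End MGroup.

(* Second cohomology of G with coefficients in K^x, with trivial action. *)
Section H2.
Variables (G : finGroupType) (K : fieldType).
Local Notation cochain := {ffun G * G -> mgroup K}.

Definition Z2 : {pred cochain} := fun f =>
  `[< forall x y z : G, f (x, y) * f (x * y, z) = f (y, z) * f (x, y * z) >].

Definition B2 : {pred cochain} := fun f =>
  `[< exists c : {ffun G -> mgroup K},
        forall x y : G, f (x, y) = c x * c y * (c (x * y))^-1 >].

Let mC (x y : mgroup K) : x * y = y * x. Proof. exact: mgroup_mulC. Qed.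
Let m4 (a b c d : mgroup K) : a * b * (c * d) = a * c * (b * d).
Proof. by rewrite -!mulgA (mulgA b) (mC b c) -mulgA. Qed.

Fact Z2_mul : mulg_closed Z2.
Proof.
move=> f g /asboolP Hf /asboolP Hg; apply/asboolP => x y z.
by rewrite !ffunE m4 Hf Hg m4.
Qed.
Fact Z2_one : 1 \in Z2.
Proof. by apply/asboolP => x y z; rewrite !ffunE. Qed.
Fact Z2_inv : invg_closed Z2.
Proof.
move=> f /asboolP Hf; apply/asboolP => x y z.
by rewrite !ffunE -!invgM mC Hf mC.
Qed.
HB.instance Definition _ := isMulClosed.Build cochain Z2 Z2_mul.
HB.instance Definition _ := isMul1Closed.Build cochain Z2 Z2_one.
HB.instance Definition _ := isInvClosed.Build cochain Z2 Z2_inv.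

Lemma B2_sub : {subset B2 <= Z2}.
Proof.
move=> f /asboolP[c Hc]; apply/asboolP => x y z; rewrite !Hc.
have -> : x * (y * z) = x * y * z by rewrite mulgA.
rewrite (mC (c x) (c (y * z))) !mulgA !mulgVK; congr (_ * _).
by rewrite -[LHS]mulgA mC.
Qed.

Definition H2 := sect Z2 B2.
HB.instance Definition _ := Group.on H2.
End H2.

Definition schur_multiplier (R : realType) (G : finGroupType) :=
  H2 G (complex R).
HB.instance Definition _ R G := Group.on (@schur_multiplier R G).

(* H is a Schur cover of G, as witnessed by the subgroup M of H and the
   isomorphism theta identifying H / M with G. *)
Definition schur_cover (R : realType) (G : finGroupType) (H : groupType)
    (M : groupClosed H) (theta : {hom quot M -> G}) : Prop :=
  [/\ bijective theta,
      {subset M <= der (fullg H)},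
      {subset M <= center H} &
      isog (sgroup M) (schur_multiplier R G)].

(* Main.v *)
From HB Require Import structures.
From mathcomp Require Import all_boot ssralg ssrnum poly matrix zmodp mxalgebra.
From mathcomp Require Import fingroup classical_sets reals complex.
From mathcomp Require Import generic_quotient boolp.
Require Import Defs.

(** Write H' for the derived subgroup of H. Choose by freeness a homomorphism
    q : F -> H lifting F -> G. It is onto, because M lies in H', and it maps
    N onto M and kills [N, F], because M is central. The proof rests on two facts.

    The first is Hopf's formula in the form: the kernel of q meets F' in [N, F]
    ([multiplier_kernel]). Since q maps N /\ F' onto M, which is isomorphic to
    H^2(G, C^x) and finite ([H2_finite]), it suffices that N /\ F' modulo [N, F]
    has no more elements than H^2(G, C^x). Characters of the abelian group
    N / [N, F] separate its elements, C^x being divisible ([char_separates]);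
    transgression sends such a character to a 2-cocycle of G; and two characters
    with cohomologous transgressions agree on N /\ F' ([trg_trivial]). So the
    elements of N /\ F' modulo [N, F] yield distinct evaluation characters that
    factor through H^2(G, C^x), and independence of characters bounds their
    number ([card_multiplier_le]).

    The second is that the exterior square W of G, i.e. the subgroup of tau(G)
    generated by the x /\ y = [x, y^*], can be recovered from commutators in F.
    There is a group C over G containing W in which [a, b] is the wedge of the
    images of a and b in G, and which maps onto G ([wedge_cover_lift]). It is
    built from W, which satisfies this by its crossed module identities, by
    adjoining the elements of G one at a time: the formula
    c |-> c (p(c) /\ g) defines the conjugation by an element above g, and the
    semidirect product with <g> is again such a group. Since F is free, F -> G
    lifts to phi : F -> C, and phi kills [N, F].

    Part (b): the map (x, y, z) |-> (q x, q y, alpha(q z)) sends K(F, 3) onto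
    T(H), because alpha inverts H/H'; because alpha inverts M, the preimage of
    T(M) consists of the triples of N^3 with product in the kernel of q, hence
    in [N, F], and these form the normal closure of K(N, 3) ([Ktilde_isog_T]).

    Part (a): g |-> (g, 1, g) and g^* |-> (1, g, g), computed on preimages in H,
    define a homomorphism from tau(G) onto T(H)/T(M). An element of its kernel
    is a product x y^* w with w in W; comparing coordinates gives x = y = 1 and
    w = x_1 /\ y_1 ... where the corresponding product of commutators in F' is
    killed by q, hence lies in [N, F], so that its image w under phi is trivial
    ([tau_isog_T]). *)

Set Implicit Arguments.
Unset Strict Implicit.
Unset Printing Implicit Defensive.
Local Open Scope group_scope.

(** * Subgroups, quotients and homomorphisms *)

Lemma groupClosed_of (X : groupType) (P : X -> Prop) :
  P 1 -> (forall x y, P x -> P y -> P (x * y)) -> (forall x, P x -> P x^-1) ->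
  exists S : groupClosed X, forall x, x \in S <-> P x.
Proof.
move=> P1 PM PV; pose S : {pred X} := fun x => `[< P x >].
have S1 : 1 \in S by apply/asboolP.
have SM : mulg_closed S.
  by move=> u v /asboolP Pu /asboolP Pv; apply/asboolP; exact: PM.
have SV : invg_closed S by move=> u /asboolP Pu; apply/asboolP; exact: PV.
pose SC := isMulClosed.Build X S SM.
pose S1C := isMul1Closed.Build X S S1.
pose SIC := isInvClosed.Build X S SV.
pose SG : groupClosed X := HB.pack S SC S1C SIC.
by exists SG => x; split=> /asboolP.
Qed.

Lemma gen_ind (X : groupType) (A : {pred X}) (P : X -> Prop) :
  P 1 -> (forall x y, P x -> P y -> P (x * y)) -> (forall x, P x -> P x^-1) ->
  (forall x, x \in A -> P x) -> forall x, x \in gen A -> P x.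
Proof.
move=> P1 PM PV PA x /asboolP Ax; have [S SP] := groupClosed_of P1 PM PV.
by apply/SP/Ax => u /PA/SP.
Qed.

Lemma ncl_ind (X : groupType) (A : {pred X}) (P : X -> Prop) :
  P 1 -> (forall x y, P x -> P y -> P (x * y)) -> (forall x, P x -> P x^-1) ->
  (forall x y, P x -> P (x ^ y)) ->
  (forall x, x \in A -> P x) -> forall x, x \in ncl A -> P x.
Proof.
move=> P1 PM PV PJ PA x /asboolP Ax; have [S SP] := groupClosed_of P1 PM PV.
by apply/SP/Ax => [u y /SP Pu|u /PA/SP //]; apply/SP/PJ.
Qed.

Lemma mem_commg_der (X : groupType) (S : {pred X}) x y :
  x \in S -> y \in S -> [~ x, y] \in der S.
Proof. by move=> Sx Sy; apply/mem_gen/asboolP; exists x, y. Qed.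

Lemma der_hom (X Y : groupType) (f : {hom X -> Y}) x :
  x \in der (fullg X) -> f x \in der (fullg Y).
Proof.
move: x; apply: gen_ind => [|x y Hx Hy|x Hx|_ /asboolP[x [y [_ _ ->]]]].
- by rewrite gmulf1 gpred1.
- by rewrite gmulfM gpredM.
- by rewrite gmulfV gpredV.
- by rewrite gmulfR mem_commg_der.
Qed.

(** A homomorphism is trivial on the derived subgroup of [S] as soon as the
    images of the elements of [S] commute. *)
Lemma morph_der1 (X Y : groupType) (S : {pred X}) (f : {hom X -> Y}) x :
  (forall u v, u \in S -> v \in S -> commute (f u) (f v)) ->
  x \in der S -> f x = 1.
Proof.
move=> fC; move: x.
apply: gen_ind => [|x y Hx Hy|x Hx|_ /asboolP[x [y [Sx Sy ->]]]].
- by rewrite gmulf1.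
- by rewrite gmulfM Hx Hy mulg1.
- by rewrite gmulfV Hx invg1.
- by rewrite gmulfR; apply/eqP/commgP; exact: fC.
Qed.

Lemma morph_mul1 (X Y : groupType) (f : X -> Y) :
  {morph f : x y / x * y} -> f 1 = 1.
Proof. by move=> fM; apply: (@mulgI _ (f 1)); rewrite -fM !mulg1. Qed.

(** A multiplicative map between groups, as a homomorphism. *)
Definition mkhom (X Y : groupType) (f : X -> Y)
    (fM : {morph f : x y / x * y}) : {hom X -> Y} :=
  HB.pack f (isUMagmaMorphism.Build X Y f (morph_mul1 fM, fM)).

Lemma isog_sym (X Y : groupType) : isog X Y -> isog Y X.
Proof.
case=> f [g fK gK]; exists (mkhom (can2_gmulfM fK gK)).
by exists f.
Qed.

Lemma isog_trans (Y X Z : groupType) : isog X Y -> isog Y Z -> isog X Z.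
Proof.
move=> [f bf] [g bg]; exists (mkhom (comp_gmulfM g f)).
exact: (bij_comp bg bf).
Qed.

Lemma inj_surj_bij (X Y : choiceType) (f : X -> Y) :
  injective f -> (forall y, exists x, f x = y) -> bijective f.
Proof.
move=> fI fS; have [g gK] := choice fS.
by exists g => // x; apply: fI; rewrite gK.
Qed.

(** A homomorphism whose kernel contains that of a surjective one [f] factors
    through [f]. *)
Lemma hom_factor (X Y Z : groupType) (f : {hom X -> Y}) (g : {hom X -> Z}) :
  (forall y, exists x, f x = y) -> (forall x, f x = 1 -> g x = 1) ->
  exists h : {hom Y -> Z}, forall x, h (f x) = g x.
Proof.
move=> fS fg1; have [s sK] := choice fS.
have gE x y : f x = f y -> g x = g y.
  by move=> fxy; apply/divg1_eq; rewrite -gmulfF fg1 // gmulfF fxy mulgV.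
have hM : {morph (g \o s) : x y / x * y}.
  by move=> x y /=; rewrite -gmulfM; apply: gE; rewrite gmulfM !sK.
by exists (mkhom hM) => x; apply: gE; rewrite sK.
Qed.

Lemma piq_surj (X : groupType) (A : {pred X}) (y : quot A) :
  exists x, piq A x = y.
Proof. by exists (repr y); exact: reprqK. Qed.

Lemma quot_lift (X Y : groupType) (A : {pred X}) (f : {hom X -> Y}) :
  (forall x, x \in A -> f x = 1) ->
  exists h : {hom quot A -> Y}, forall x, h (piq A x) = f x.
Proof.
move=> fA; apply: (@hom_factor _ _ _ (piq A : {hom X -> quot A})).
  exact: piq_surj.
move=> x /piqE; move: x.
apply: ncl_ind => // [|x y fx fy|x fx|x y fx]; first exact: gmulf1.
- by rewrite gmulfM fx fy mulg1.
- by rewrite gmulfV fx invg1.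
- by rewrite gmulfJ fx conj1g.
Qed.

(** First isomorphism theorem. *)
Lemma quot_isog (X Y : groupType) (A : {pred X}) (f : {hom X -> Y}) :
  (forall y, exists x, f x = y) -> (forall x, f x = 1 <-> x \in ncl A) ->
  isog (quot A) Y.
Proof.
move=> fS fK; have [h hE] := @quot_lift X Y A f (fun x Ax => (fK x).2 (mem_ncl Ax)).
exists h; apply: inj_surj_bij => [|y]; last first.
  by have [x <-] := fS y; exists (piq A x).
apply: gmulf_inj => z; have [x <-] := piq_surj z.
by rewrite hE => /fK Ax; apply/piqE.
Qed.

Lemma restr_ncl (X : groupType) (S N : groupClosed X) (u : sgroup S) :
  normalp N -> (u \in ncl (restr (S := S) N)) = (val u \in N).
Proof.
move=> nN; apply/idP/idP; last by move=> Nu; exact: mem_ncl.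
move: u; apply: ncl_ind => // [|u v|u|u v]; rewrite ?gmulf1 ?gpred1 //.
- by rewrite gmulfM => *; rewrite gpredM.
- by rewrite gmulfV gpredV.
- by rewrite gmulfJ => *; exact: nN.
Qed.

(** The elements of [S] that become trivial in the section S / N. *)
Lemma sect_eq1 (X : groupType) (S N : groupClosed X) (u : sgroup S) :
  normalp N -> (piq (restr (S := S) N) u = 1) <-> (val u \in N).
Proof. by move=> nN; rewrite -restr_ncl //; exact: piqE. Qed.

Lemma quot_bij_surj (X Y : groupType) (A : {pred X}) (f : {hom quot A -> Y}) :
  bijective f -> forall y, exists x, f (piq A x) = y.
Proof.
by case=> g _ gK y; have [x Ex] := piq_surj (g y); exists x; rewrite Ex gK.
Qed.

Lemma quot_bij_ker (X Y : groupType) (N : groupClosed X)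
    (f : {hom quot N -> Y}) : normalp N -> bijective f ->
  forall x, (x \in N) = (f (piq N x) == 1).
Proof.
move=> nN bf x; rewrite -(ncl_id nN) gmulf_eq1; last exact: bij_inj.
by apply/idP/eqP => /piqE.
Qed.

Lemma centerC (X : groupType) (m x : X) : m \in center X -> m * x = x * m.
Proof. by move=> /asboolP; exact. Qed.

Lemma center_conj (X : groupType) (m x : X) : m \in center X -> m ^ x = m.
Proof. by move=> cm; rewrite conjgE (centerC x) // mulKg. Qed.

Lemma commgM_center (X : groupType) (x y m n : X) :
  m \in center X -> n \in center X -> [~ x * m, y * n] = [~ x, y].
Proof.
have cl a b c : c \in center X -> [~ a * c, b] = [~ a, b].
  move=> cc; rewrite [LHS]commgEl conjMg (center_conj b cc) invgM -mulgA.
  by rewrite (mulgA a^-1) -commgEl -(centerC _ cc) mulKg.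
by move=> cm cn; rewrite cl // -invgR cl // invgR.
Qed.

(** A homomorphism that is onto modulo the centre maps the derived subgroup
    onto the derived subgroup. *)
Lemma der_lift (X Y : groupType) (f : {hom X -> Y}) :
  (forall y, exists x, (f x)^-1 * y \in center Y) ->
  forall y, y \in der (fullg Y) -> exists2 x, x \in der (fullg X) & f x = y.
Proof.
move=> fS; apply: gen_ind => [|a b [x Dx <-] [y Dy <-]|a [x Dx <-]|].
- by exists 1; rewrite ?gpred1 ?gmulf1.
- by exists (x * y); rewrite ?gpredM ?gmulfM.
- by exists x^-1; rewrite ?gpredV ?gmulfV.
- move=> _ /asboolP[a [b [_ _ ->]]]; have [x cx] := fS a; have [y cy] := fS b.
  exists [~ x, y]; first exact: mem_commg_der.
  by rewrite gmulfR -(commgM_center (f x) (f y) cx cy) !mulVKg.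
Qed.

(** Universal property of the free product. *)
Section FreeProductUniversal.
Variables (G1 G2 Y : groupType) (f : {hom G1 -> Y}) (g : {hom G2 -> Y}).

Let letter (a : G1 + G2) : Y := match a with inl x => f x | inr y => g y end.
Let word (w : seq (G1 + G2)) : Y := \prod_(a <- w) letter a.

Let word_cong v w : fp_cong v w -> word v = word w.
Proof.
rewrite /word.
elim=> {v w} [//|//|u v w _ -> _ -> //|v v' w w' _ IH1 _ IH2||||].
- by rewrite !big_cat /= IH1 IH2.
- by rewrite big_cons !big_nil /= gmulf1 mulg1.
- by rewrite big_cons !big_nil /= gmulf1 mulg1.
- by move=> x y; rewrite !big_cons !big_nil /= gmulfM !mulg1.
- by move=> x y; rewrite !big_cons !big_nil /= gmulfM !mulg1.
Qed.

Lemma fprod_lift : exists h : {hom fprod G1 G2 -> Y},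
  (forall x, h (fp_inl G2 x) = f x) /\ (forall y, h (fp_inr G1 y) = g y).
Proof.
pose h (p : fprod G1 G2) := word (repr p).
have hE w : h (fp_pi w) = word w.
  by apply: word_cong; apply/fp_piP; exact: fp_reprK.
have hM : {morph h : p q / p * q}.
  move=> p q; rewrite -(fp_reprK p) -(fp_reprK q) [_ * _]fp_mulE !hE.
  by rewrite /word big_cat.
exists (mkhom hM); split=> x; rewrite [LHS]hE /word big_cons big_nil mulg1 //.
Qed.
End FreeProductUniversal.

(** * The exterior square inside tau(G) *)

Section Tau.
Variable G : groupType.
Implicit Types (x y z g : G).

(** The images in tau(G) of [g] and of its copy [g^*]. *)
Definition tau_in : {hom G -> tau G} :=
  piq (@nabla G) \o (piq (@nu_relators G) \o @fp_inl G G).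
Definition tau_star : {hom G -> tau G} :=
  piq (@nabla G) \o (piq (@nu_relators G) \o @fp_inr G G).

Arguments tau_in : simpl never.
Arguments tau_star : simpl never.

Lemma tau_ind (P : tau G -> Prop) :
  P 1 -> (forall x t, P t -> P (tau_in x * t)) ->
  (forall y t, P t -> P (tau_star y * t)) -> forall t, P t.
Proof.
move=> P1 Pi Pj t; have [u <-] := piq_surj t; have [p <-] := piq_surj u.
elim/fprod_ind: p => [|x p IH|y p IH]; first by rewrite !gmulf1.
- by rewrite !gmulfM; exact: (Pi x (piq _ (piq _ p))).
- by rewrite !gmulfM; exact: (Pj y).
Qed.

(** Universal property of tau(G). *)
Lemma tau_lift (Y : groupType) (f g : {hom G -> Y}) :
  (forall x y z, [~ f x, g y] ^ f z = [~ f (x ^ z), g (y ^ z)]) ->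
  (forall x y z, [~ f x, g y] ^ g z = [~ f (x ^ z), g (y ^ z)]) ->
  (forall x, [~ f x, g x] = 1) ->
  exists h : {hom tau G -> Y},
    (forall x, h (tau_in x) = f x) /\ (forall x, h (tau_star x) = g x).
Proof.
move=> Hf Hg H1; have [h0 [h0i h0j]] := fprod_lift f g.
have [|h1 h1E] := @quot_lift _ _ (@nu_relators G) h0.
  move=> _ /asboolP[x [y [z [->|->]]]];
    rewrite gmulfM gmulfV gmulfJ !gmulfR !(h0i, h0j).
    by rewrite Hf mulgV.
  by rewrite Hg mulgV.
have [|h hE] := @quot_lift _ _ (@nabla G) h1.
  apply: gen_ind => [|x y Hx Hy|x Hx|_ /asboolP[x ->]].
  - exact: gmulf1.
  - by rewrite gmulfM Hx Hy mulg1.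
  - by rewrite gmulfV Hx invg1.
  - by rewrite gmulfR !h1E h0i h0j.
by exists h; split=> x; rewrite /= hE h1E ?h0i ?h0j.
Qed.

Lemma tau_relE x y z :
  [~ tau_in x, tau_star y] ^ tau_in z
     = [~ tau_in (x ^ z), tau_star (y ^ z)] /\
  [~ tau_in x, tau_star y] ^ tau_star z
     = [~ tau_in (x ^ z), tau_star (y ^ z)].
Proof.
have [E1 E2] := nu_relE x y z.
split.
  have := congr1 (piq (@nabla G)) E1; rewrite gmulfJ !gmulfR; exact.
have := congr1 (piq (@nabla G)) E2; rewrite gmulfJ !gmulfR; exact.
Qed.

Lemma tau_comm1 x : [~ tau_in x, tau_star x] = 1.
Proof.
suff: piq (@nabla G) [~ nu_in x, nu_star x] = 1 by rewrite gmulfR.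
by apply/piqE/mem_ncl/mem_gen/asboolP; exists x.
Qed.

Lemma tau_bnd_ex : exists h : {hom tau G -> G},
  (forall x, h (tau_in x) = x) /\ (forall x, h (tau_star x) = x).
Proof.
by apply: (@tau_lift G idfun idfun) => x *; rewrite /= ?conjRg ?commgg.
Qed.

(** The homomorphism tau(G) -> G folding the two copies of [G]; on the
    commutators of the two copies it is the boundary map of the exterior
    square. *)
Definition tau_bnd : {hom tau G -> G} := projT1 (cid tau_bnd_ex).
Lemma tau_bndi x : tau_bnd (tau_in x) = x.
Proof. by rewrite /tau_bnd; case: cid => h []. Qed.
Lemma tau_bndj x : tau_bnd (tau_star x) = x.
Proof. by rewrite /tau_bnd; case: cid => h []. Qed.

Definition wedge_gens : {pred tau G} :=
  fun u => `[< exists x y, u = [~ tau_in x, tau_star y] >].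
Definition wedge_pred : {pred tau G} := gen wedge_gens.
HB.instance Definition _ := GroupClosed.on wedge_pred.

(** The nonabelian exterior square of [G], realised as the subgroup of tau(G)
    generated by the commutators of the two copies of [G]. *)
Definition wedge := sgroup wedge_pred.
HB.instance Definition _ := Group.on wedge.

Fact wd_subproof x y : [~ tau_in x, tau_star y] \in wedge_pred.
Proof. by apply/mem_gen/asboolP; exists x, y. Qed.
(** The generator x /\ y of the exterior square. *)
Definition wd x y : wedge := exist (fun t => t \in wedge_pred) _ (wd_subproof x y).

Fact wact_subproof (u : wedge) g : val u ^ tau_in g \in wedge_pred.
Proof.
case: u => u /=; move: u.
apply: gen_ind => [|x y Hx Hy|x Hx|_ /asboolP[x [y ->]]].
- by rewrite conj1g gpred1.
- by rewrite conjMg gpredM.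
- by rewrite conjVg gpredV.
- by rewrite (tau_relE _ _ _).1 wd_subproof.
Qed.
(** The action of [G] on its exterior square. *)
Definition wact (u : wedge) g : wedge :=
  exist (fun t => t \in wedge_pred) _ (wact_subproof u g).

Lemma val_wd x y : val (wd x y) = [~ tau_in x, tau_star y].
Proof. by []. Qed.
Lemma val_wact u g : val (wact u g) = val u ^ tau_in g.
Proof. by []. Qed.

Lemma wedge_ind (P : wedge -> Prop) :
  P 1 -> (forall u v, P u -> P v -> P (u * v)) -> (forall u, P u -> P u^-1) ->
  (forall x y, P (wd x y)) -> forall u, P u.
Proof.
move=> P1 PM PV Pw [u Wu].
pose Q t := exists Wt : t \in wedge_pred, P (exist (fun t => t \in wedge_pred) t Wt).
suff [Wu' Pu] : Q u by rewrite (bool_irrelevance Wu Wu').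
move: u Wu; apply: gen_ind => [|x y [Wx Px] [Wy Py]|x [Wx Px]|].
- by exists gpred1; have := P1; congr P; exact: val_inj.
- by exists (gpredM _ _ Wx Wy); have := PM _ _ Px Py; congr P; exact: val_inj.
- by exists (gpredVr _ Wx); have := PV _ Px; congr P; exact: val_inj.
- move=> _ /asboolP[x [y ->]]; exists (wd_subproof x y); exact: Pw.
Qed.

Lemma wactM u v g : wact (u * v) g = wact u g * wact v g.
Proof. by apply/val_inj; rewrite valM !val_wact valM conjMg. Qed.
Lemma wact1 g : wact 1 g = 1.
Proof. by apply/val_inj; rewrite val_wact val1 conj1g. Qed.
Lemma wactV u g : wact u^-1 g = (wact u g)^-1.
Proof. by apply/val_inj; rewrite gmulfV !val_wact gmulfV conjVg. Qed.
Lemma wactg1 u : wact u 1 = u.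
Proof. by apply/val_inj; rewrite val_wact gmulf1 conjg1. Qed.
Lemma wactgM u x y : wact u (x * y) = wact (wact u x) y.
Proof. by apply/val_inj; rewrite !val_wact gmulfM conjgM. Qed.

Lemma wact_wd x y z : wact (wd x y) z = wd (x ^ z) (y ^ z).
Proof. by apply/val_inj; rewrite val_wact !val_wd (tau_relE _ _ _).1. Qed.

(** Both copies of [G] act in the same way on the exterior square, hence any
    element of tau(G) acts on it through [tau_bnd]. *)
Lemma wactE u t : val (wact u (tau_bnd t)) = val u ^ t.
Proof.
elim/tau_ind: t u => [|x t IH|y t IH] u.
- by rewrite gmulf1 wactg1 conjg1.
- by rewrite gmulfM wactgM IH tau_bndi conjgM.
- rewrite gmulfM wactgM IH tau_bndj conjgM val_wact; congr (_ ^ t).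
  elim/wedge_ind: u => [|u v Hu Hv|u Hu|a b]; rewrite ?val1 ?conj1g //.
  + by rewrite valM !conjMg Hu Hv.
  + by rewrite gmulfV !conjVg Hu.
  + by rewrite val_wd (tau_relE _ _ _).1 (tau_relE _ _ _).2.
Qed.

(** The Peiffer identity of the exterior square as a crossed module. *)
Lemma wact_bnd u v : wact u (tau_bnd (val v)) = u ^ v.
Proof. by apply/val_inj; rewrite wactE gmulfJ. Qed.

Lemma tau_bnd_wd x y : tau_bnd (val (wd x y)) = [~ x, y].
Proof. by rewrite val_wd gmulfR tau_bndi tau_bndj. Qed.

Lemma wdMl x y z : wd (x * y) z = wact (wd x z) y * wd y z.
Proof.
apply/val_inj; rewrite valM val_wact !val_wd gmulfM.
by rewrite !commgEr conjMg conjgM -[RHS]mulgA (conjVg _ (tau_in y)) mulVKg.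
Qed.

Lemma wdMr x y z : wd x (y * z) = wd x z * wact (wd x y) z.
Proof.
apply/val_inj; rewrite valM -{3}(tau_bndj z) wactE !val_wd gmulfM.
by rewrite !commgEl conjgM [in RHS]conjMg -[RHS]mulgA (conjVg _ (tau_star z)) mulVKg.
Qed.

Lemma wdxx x : wd x x = 1.
Proof. by apply/val_inj; rewrite val_wd tau_comm1. Qed.

Lemma wd1g x : wd 1 x = 1.
Proof. by apply/val_inj; rewrite val_wd gmulf1 comm1g. Qed.

Lemma wdg1 x : wd x 1 = 1.
Proof. by apply/val_inj; rewrite val_wd gmulf1 commg1. Qed.

Lemma wact_inj x : injective (wact^~ x).
Proof. by move=> u v /(congr1 (wact^~ x^-1)); rewrite -!wactgM mulgV !wactg1. Qed.

Lemma wdV x y : (wd x y)^-1 = wd y x.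
Proof.
apply/(mulgI (wd x y)); rewrite mulgV; apply: (@wact_inj y).
rewrite wactM wact1 -[LHS](wdxx (x * y)) wdMl !wdMr !wdxx.
by rewrite wact1 mulg1 mul1g.
Qed.

(** The identity x /\ yz = (x /\ y) (x^y /\ z), obtained by expanding
    x /\ yz in two ways. *)
Lemma wd_conjl x y z : wd x y * wd (x ^ y) z = wd x z * wact (wd x y) z.
Proof.
by rewrite -wdMr [in RHS]conjgCV wdMr wact_wd conjgKV.
Qed.

Lemma wdVl x z : wact (wd x^-1 z) x = (wd x z)^-1.
Proof.
by apply: (@mulIg _ (wd x z)); rewrite -wdMl mulVg mulVg wd1g.
Qed.

(** The identity (d u) /\ g = u^-1 u^g, where d is the boundary map; with
    [wact_bnd] it determines the wedge of two boundaries. *)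
Lemma wd_bnd u g : wd (tau_bnd (val u)) g = u^-1 * wact u g.
Proof.
elim/wedge_ind: u => [|u v Hu Hv|u Hu|x y].
- by rewrite val1 gmulf1 wd1g wact1 mulg1 invg1.
- rewrite valM gmulfM wdMl Hu Hv wact_bnd wactM invgM conjgE.
  by rewrite !mulgA mulgK.
- have := wdMl (tau_bnd (val u^-1)) (tau_bnd (val u)) g.
  rewrite -gmulfM -valM mulVg val1 gmulf1 wd1g wact_bnd Hu => E.
  apply: (@conjg_inj _ u); apply: (@mulIg _ (u^-1 * wact u g)).
  by rewrite -E conjgE wactV invgK !mulgA mulVg mul1g mulgK mulVg.
- (* Expand [x, y] = x^-1 x^y on the left of the wedge; the conjugation by
     [x, y] is the one by x /\ y, and [wd_conjl] rewrites x^y /\ g. *)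
  rewrite tau_bnd_wd wact_wd commgEl wdMl.
  have -> : wact (wd x^-1 g) (x ^ y) = (wd x g)^-1 ^ wd x y.
    by rewrite -wdVl -wact_bnd tau_bnd_wd commgEl -wactgM mulVKg.
  apply: (@mulgI _ (wd x y)); rewrite mulVKg conjgE -!mulgA mulVKg.
  apply: (@mulgI _ (wd x g)); rewrite mulVKg wd_conjl; congr (_ * _).
  by rewrite wact_wd.
Qed.

End Tau.

(** * Groups whose commutators are given by the exterior square *)

Section Cover.
Variable G : groupType.
Implicit Types (x y z g : G) (u v : wedge G).

(** A group over [G] containing the exterior square of [G], in which the
    commutator of two elements is the wedge of their images in [G]. *)
Record wedge_cover := WedgeCover {
  wc_sort : groupType;
  wc_p : {hom wc_sort -> G};
  wc_i : {hom wedge G -> wc_sort};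
  wc_i_inj : injective wc_i;
  wc_pi : forall u, wc_p (wc_i u) = tau_bnd G (val u);
  wc_comm : forall a b, [~ a, b] = wc_i (wd (wc_p a) (wc_p b)) }.

Lemma wedge_comm u v :
  [~ u, v] = wd (tau_bnd G (val u)) (tau_bnd G (val v)).
Proof. by rewrite wd_bnd wact_bnd commgEl. Qed.

(** The exterior square itself, by its crossed module structure. *)
Definition wedge_cover0 : wedge_cover :=
  @WedgeCover (wedge G) (mkhom (comp_gmulfM (tau_bnd G) (val : wedge G -> tau G)))
    idfun (fun u v e => e) (fun u => erefl) wedge_comm.

Section Extend.
Variables (C : wedge_cover) (D : groupClosed G).
Local Notation E := (wc_sort C).
Local Notation p := (wc_p C).
Local Notation i := (wc_i C).
Implicit Types (a b c : E).

(** The action of a wedge cover on the exterior square by conjugation is the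
    one of its image in [G]. *)
Lemma wc_act u c : i u ^ c = i (wact u (p c)).
Proof.
apply: (@mulgI _ (i u)^-1).
by rewrite -commgEl wc_comm wc_pi wd_bnd gmulfM gmulfV.
Qed.

(** The automorphism of a wedge cover that conjugation by an element above [x]
    would induce, were there one. *)
Definition wc_th x c : E := c * i (wd (p c) x).

Lemma wc_thM x : {morph wc_th x : c d / c * d}.
Proof.
move=> c d; rewrite /wc_th gmulfM wdMl gmulfM -wc_act.
rewrite -[LHS]mulgA -[RHS]mulgA; congr (_ * _).
by rewrite (mulgA d) -conjgC -[LHS]mulgA.
Qed.

Lemma wc_p_th x c : p (wc_th x c) = p c ^ x.
Proof. by rewrite gmulfM wc_pi tau_bnd_wd commgEl mulVKg. Qed.

Lemma wc_th_comp x y c : wc_th y (wc_th x c) = wc_th (x * y) c.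
Proof.
rewrite {1}/wc_th wc_p_th /wc_th -mulgA -gmulfM; congr (_ * i _).
by rewrite wd_conjl wdMr.
Qed.

Lemma wc_th1 c : wc_th 1 c = c.
Proof. by rewrite /wc_th wdg1 gmulf1 mulg1. Qed.

(** The semidirect product of [C] by a subgroup [D] of [G] acting by
    [wc_th]; the pair (x, c) stands for the product x c. *)
Definition wc_sdp := (sgroup D * E)%type.
HB.instance Definition _ := Choice.on wc_sdp.
Implicit Types (s t : wc_sdp).

Definition wc_sdp_one : wc_sdp := (1, 1).
Definition wc_sdp_mul s t : wc_sdp :=
  (s.1 * t.1, wc_th (val t.1) s.2 * t.2).
Definition wc_sdp_inv s : wc_sdp := (s.1^-1, (wc_th (val s.1)^-1 s.2)^-1).

Let th1 x : wc_th x 1 = 1. Proof. exact: morph_mul1 (wc_thM x). Qed.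
Let thV x c : wc_th x c^-1 = (wc_th x c)^-1.
Proof. exact: (gmulfV (mkhom (wc_thM x))). Qed.

Fact wc_sdp_mulA : associative wc_sdp_mul.
Proof.
move=> [x a] [y b] [z c]; rewrite /wc_sdp_mul /= mulgA; congr (_, _).
by rewrite wc_thM wc_th_comp mulgA.
Qed.
Fact wc_sdp_mul1 : left_id wc_sdp_one wc_sdp_mul.
Proof. by move=> [x a]; rewrite /wc_sdp_mul /= mul1g th1 mul1g. Qed.
Fact wc_sdp_mulr1 : right_id wc_sdp_one wc_sdp_mul.
Proof. by move=> [x a]; rewrite /wc_sdp_mul /= mulg1 wc_th1 mulg1. Qed.
Fact wc_sdp_mulV : left_inverse wc_sdp_one wc_sdp_inv wc_sdp_mul.
Proof.
move=> [x a]; rewrite /wc_sdp_mul /= mulVg thV wc_th_comp mulVg wc_th1.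
by rewrite mulVg.
Qed.
Fact wc_sdp_mulrV : right_inverse wc_sdp_one wc_sdp_inv wc_sdp_mul.
Proof. by move=> [x a]; rewrite /wc_sdp_mul /= !mulgV. Qed.
HB.instance Definition _ := isGroup.Build wc_sdp
  wc_sdp_mulA wc_sdp_mul1 wc_sdp_mulr1 wc_sdp_mulV wc_sdp_mulrV.

Lemma sdp_mulE s t : s * t = (s.1 * t.1, wc_th (val t.1) s.2 * t.2) :> wc_sdp.
Proof. by []. Qed.

Definition sdp_p s : G := val s.1 * p s.2.
Fact sdp_pM : {morph sdp_p : s t / s * t}.
Proof.
move=> s t; rewrite /sdp_p sdp_mulE /= gmulfM wc_p_th.
rewrite -[LHS]mulgA -[RHS]mulgA; congr (_ * _).
by rewrite (mulgA (val t.1)) -conjgC -[LHS]mulgA.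
Qed.

Definition sdp_l (x : sgroup D) : wc_sdp := (x, 1).
Fact sdp_lM : {morph sdp_l : x y / x * y}.
Proof. by move=> x y; rewrite sdp_mulE /= th1 mulg1. Qed.
Definition sdp_r (c : E) : wc_sdp := (1, c).
Fact sdp_rM : {morph sdp_r : c d / c * d}.
Proof. by move=> c d; rewrite sdp_mulE /= wc_th1 mulg1. Qed.
Fact sdp_iM : {morph (sdp_r \o i) : u v / u * v}.
Proof. by move=> u v; rewrite /= gmulfM sdp_rM. Qed.

Lemma sdp_lr s : s = sdp_l s.1 * sdp_r s.2.
Proof. by case: s => x c; rewrite sdp_mulE /= th1 mulg1 mul1g. Qed.

Lemma sdp_pl (x : sgroup D) : sdp_p (sdp_l x) = val x.
Proof. by rewrite /sdp_p /= gmulf1 mulg1. Qed.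
Lemma sdp_pr c : sdp_p (sdp_r c) = p c.
Proof. by rewrite /sdp_p /= mul1g. Qed.

Lemma sdp_conj c (x : sgroup D) : sdp_r c ^ sdp_l x = sdp_r (wc_th (val x) c).
Proof.
apply: (@mulgI _ (sdp_l x)); rewrite -conjgC !sdp_mulE /=.
by rewrite th1 !(mul1g, mulg1).
Qed.

Lemma sdp_act u s : sdp_r (i u) ^ s = sdp_r (i (wact u (sdp_p s))).
Proof.
rewrite (sdp_lr s) conjgM sdp_conj sdp_pM sdp_pl sdp_pr wactgM.
rewrite -(gmulfJ (mkhom sdp_rM)) /= -wc_act; congr (sdp_r (_ ^ _)).
by rewrite /wc_th wc_pi wd_bnd -gmulfM mulVKg.
Qed.

Hypothesis Dab : forall x y, x \in D -> y \in D -> x * y = y * x.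
Hypothesis Dwd : forall x y, x \in D -> y \in D -> wd x y = 1.

(** Both sides are multiplicative in each argument up to the same action, so it
    is enough to compare them when each argument comes from one of the two
    factors. *)
Lemma sdp_comm s t : [~ s, t] = sdp_r (i (wd (sdp_p s) (sdp_p t))).
Proof.
pose P s t := [~ s, t] = sdp_r (i (wd (sdp_p s) (sdp_p t))).
have rM u v : sdp_r (i (u * v)) = sdp_r (i u) * sdp_r (i v).
  by rewrite gmulfM sdp_rM.
have PMl s1 s2 t' : P s1 t' -> P s2 t' -> P (s1 * s2) t'.
  rewrite /P => E1 E2; rewrite sdp_pM wdMl rM -sdp_act -E1 -E2.
  by rewrite !commgEr conjMg conjgM -[RHS]mulgA (conjVg _ s2) mulVKg.
have Psym s' t' : P s' t' -> P t' s'.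
  move=> E'; rewrite /P -invgR E' -(gmulfV (mkhom sdp_rM)) /=.
  by rewrite -gmulfV wdV.
have Pll (x y : sgroup D) : P (sdp_l x) (sdp_l y).
  rewrite /P !sdp_pl Dwd ?gmulf1; try exact: valP.
  apply/eqP/commgP; rewrite /commute -!sdp_lM; congr sdp_l.
  by apply/val_inj; rewrite !valM Dab; try exact: valP.
have Prl c (y : sgroup D) : P (sdp_r c) (sdp_l y).
  rewrite /P sdp_pl sdp_pr commgEl sdp_conj /wc_th sdp_rM mulKg //.
have Prr c d : P (sdp_r c) (sdp_r d).
  rewrite /P !sdp_pr -wc_comm; exact: esym (gmulfR (mkhom sdp_rM) c d).
have Pl s' (y : sgroup D) : P s' (sdp_l y) by rewrite (sdp_lr s'); apply: PMl.
have Pr s' c : P s' (sdp_r c).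
  by rewrite (sdp_lr s'); apply: PMl => //; apply: Psym.
by rewrite -/(P s t) (sdp_lr t); apply: (Psym); apply: PMl; apply: (Psym).
Qed.

Fact sdp_i_inj : injective (sdp_r \o i).
Proof. by move=> u v [/wc_i_inj]. Qed.
Fact sdp_pi u : sdp_p ((sdp_r \o i) u) = tau_bnd G (val u).
Proof. by rewrite /= sdp_pr wc_pi. Qed.

(** The semidirect product, as a wedge cover. *)
Definition wedge_cover_ext : wedge_cover :=
  @WedgeCover wc_sdp (mkhom sdp_pM) (mkhom sdp_iM) sdp_i_inj sdp_pi sdp_comm.

End Extend.

Lemma gen1_comm g x y : x \in gen (pred1 g) -> y \in gen (pred1 g) ->
  forall (X : groupType) (f h : {hom G -> X}),
    commute (f g) (h g) -> commute (f x) (h y).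
Proof.
move=> gx gy X f h fg.
have {gx} cx : commute (f x) (h g).
  move: x gx; apply: gen_ind => [|x x' cx cx'|x cx|x /eqP -> //].
  - by rewrite gmulf1; apply: commute_sym; exact: commute1.
  - rewrite gmulfM; apply: commute_sym.
    by apply: commuteM; exact: commute_sym.
  - rewrite gmulfV; apply: commute_sym; apply: commuteV; exact: commute_sym.
move: y gy; apply: gen_ind => [|y y' cy cy'|y cy|y /eqP -> //].
- by rewrite gmulf1; exact: commute1.
- by rewrite gmulfM; apply: commuteM.
- by rewrite gmulfV; apply: commuteV.
Qed.

(** Adjoining cyclic subgroups of [G] one at a time, any finite list of
    elements of [G] lifts to some wedge cover. *)
Lemma wedge_cover_lift (s : seq G) :
  exists C : wedge_cover, forall g, g \in s -> exists c, wc_p C c = g.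
Proof.
elim: s => [|g s [C HC]]; first by exists wedge_cover0.
have Dab x y : x \in gen (pred1 g) -> y \in gen (pred1 g) -> x * y = y * x.
  by move=> gx gy; apply: (gen1_comm gx gy (f := idfun) (h := idfun)).
have Dwd x y : x \in gen (pred1 g) -> y \in gen (pred1 g) -> wd x y = 1.
  move=> gx gy; apply/val_inj/eqP; rewrite val_wd; apply/commgP.
  by apply: gen1_comm gx gy _ _ _ _; apply/commgP; rewrite tau_comm1.
have Hg : g \in gen (pred1 g) by apply: mem_gen; exact: eqxx.
exists (wedge_cover_ext C Dab Dwd) => h; rewrite inE => /orP[/eqP ->|/HC[c <-]].
  exists (sdp_l C (exist (fun x => x \in gen (pred1 g)) g Hg)).
  by rewrite /= sdp_pl.
by exists (sdp_r _ c); rewrite /= sdp_pr.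
Qed.

End Cover.

(** * Characters with values in an algebraically closed field *)

(** A submonoid of the natural numbers closed under differences consists of
    multiples of one of its elements. *)
Lemma nat_subgroup_dvd (P : nat -> Prop) :
  P 0 -> (forall m n, P m -> P n -> P (m + n)%N) ->
  (forall m n, P (m + n)%N -> P m -> P n) ->
  exists2 k, P k & forall n, P n -> k %| n.
Proof.
move=> P0 PD PB.
have [exP|nP] := pselect (exists n, `[< P n >] && (0 < n)%N); last first.
  exists 0%N => // n Pn; case: n Pn => // n Pn; case: nP; exists n.+1.
  by rewrite andbT; apply/asboolP.
have [k /andP[/asboolP Pk k0] kmin] := ex_minnP exP.
exists k => // n Pn; rewrite /dvdn.
have PM q : P (q * k)%N by elim: q => // q IH; rewrite mulSn; apply: PD.
have Pr : P (n %% k)%N by apply: (PB (n %/ k * k)%N); rewrite -?divn_eq.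
case: (posnP (n %% k)) => [//|r0].
have := kmin (n %% k)%N; rewrite r0 andbT => /(_ (introT (asboolP _) Pr)).
by rewrite leqNgt ltn_pmod.
Qed.

Section Roots.
Variable K : numClosedFieldType.
Local Notation U := (mgroup K).

(** A nonzero scalar, as an element of the multiplicative group. *)
Definition mgroup_of (x : K) (x0 : x != 0%R) : U :=
  exist (fun y => y != 0%R) x x0.

Lemma mgroupC (x y : U) : x * y = y * x. Proof. exact: mgroup_mulC. Qed.

Lemma mgroup_commute (x y : U) : commute x y. Proof. exact: mgroupC. Qed.

Lemma mgroupM4 (a b c d : U) : a * b * (c * d) = a * c * (b * d).
Proof. by rewrite -!mulgA (mulgA b) (mgroupC b c) -mulgA. Qed.

Lemma mgroupVM (a b : U) : (a * b)^-1 = a^-1 * b^-1.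
Proof. by rewrite invgM mgroupC. Qed.

Lemma val_mgroupX (x : U) n : val (x ^+ n) = (val x ^+ n)%R.
Proof. by elim: n => [|n IH]; rewrite ?expgS ?GRing.exprS -?IH. Qed.

Lemma mgroup_root (w : U) n : (0 < n)%N -> exists z, z ^+ n = w.
Proof.
move=> n0; pose P i := if i == 0%N then val w else 0%R.
have [x Hx] := @GRing.solve_monicpoly K n P n0.
have E : (x ^+ n = val w)%R.
  rewrite Hx; case: n n0 {Hx} => // n _; rewrite big_ord_recl /P /=.
  by rewrite GRing.expr0 GRing.mulr1 big1 ?GRing.addr0 // => i _; rewrite GRing.mul0r.
have x0 : x != 0%R.
  by apply: contraNneq (valP w) => x0; rewrite -E x0 GRing.expr0n gtn_eqF.
by exists (mgroup_of x0); apply/val_inj; rewrite val_mgroupX.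
Qed.

Lemma mgroup_unity_root n : n != 1%N -> exists2 z : U, z ^+ n = 1 & z != 1.
Proof.
case: n => [_|[//|n _]].
  (* For n = 0 any z other than 1 will do. *)
  have n1 : (-1 != 0 :> K)%R by rewrite GRing.oppr_eq0 GRing.oner_eq0.
  exists (mgroup_of n1) => //; rewrite -val_eqE /= GRing.eqr_oppLR.
  rewrite -GRing.subr_eq0 GRing.opprK -[(1 + 1)%R]/(2%:R)%R.
  by rewrite Num.Theory.pnatr_eq0.
(* A root x of 1 + X + ... + X^(n+1), which is not 1 in characteristic 0. *)
have [x Hx] := @GRing.solve_monicpoly K n.+1 (fun=> -1)%R isT.
have E : (x ^+ n.+2 = 1)%R.
  have := GRing.subrX1 x n.+2; rewrite big_ord_recr /= Hx.
  under [in X in (_ = _ * (_ + X))%R]eq_bigr do rewrite GRing.mulN1r.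
  rewrite GRing.sumrN GRing.subrr GRing.mulr0 => /eqP.
  by rewrite GRing.subr_eq0 => /eqP.
have x0 : x != 0%R.
  by apply: contra_eq_neq E => ->; rewrite GRing.expr0n /= eq_sym GRing.oner_eq0.
exists (mgroup_of x0); first by apply/val_inj; rewrite val_mgroupX.
rewrite -val_eqE /=; apply/eqP => x1; move: Hx; rewrite x1 GRing.expr1n.
under eq_bigr do rewrite GRing.expr1n GRing.mulr1.
rewrite GRing.sumrN GRing.sumr_const card_ord => /eqP.
rewrite -GRing.subr_eq0 GRing.opprK -GRing.mulrS.
by rewrite Num.Theory.pnatr_eq0.
Qed.

End Roots.

(** Characters of an abelian group separate its elements: a character of a
    subgroup that is maximal for extension is defined everywhere, because the
    multiplicative group of an algebraically closed field is divisible. *)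
Section Separation.
Variables (K : numClosedFieldType) (A : groupType).
Hypothesis AC : forall x y : A, x * y = y * x.
Local Notation U := (mgroup K).
Local Notation AU := (A * U)%type.
Implicit Types (u v t : AU) (X : set AU).

(** [X] is the graph of a character of a subgroup of [A]. *)
Definition char_graph X : Prop :=
  [/\ X 1, forall u v, X u -> X v -> X (u * v), forall u, X u -> X u^-1 &
      forall w, X (1, w) -> w = 1].

Let AUC u v : commute u v.
Proof. exact: (f_equal2 pair (AC u.1 v.1) (mgroupC u.2 v.2)). Qed.

Let AUC4 u v t (w : AU) : u * v * (t * w) = u * t * (v * w).
Proof. by rewrite -!mulgA (mulgA v) (AUC v t) -mulgA. Qed.

Let pairX (a : A) (w : U) n : (a, w) ^+ n = (a ^+ n, w ^+ n) :> AU.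
Proof. by elim: n => // n IH; rewrite !expgS IH. Qed.

(** The last condition of [char_graph] makes [X] functional. *)
Let graph_fun X a w w' : char_graph X -> X (a, w) -> X (a, w') -> w = w'.
Proof.
case=> X1 XM XV X0 Xw Xw'; apply/divg1_eq/X0.
by have := XM _ _ Xw (XV _ Xw'); congr X; congr (_, _); exact: mulgV.
Qed.

Let graphX X u n : char_graph X -> X u -> X (u ^+ n).
Proof.
by move=> [X1 XM _ _] Xu; elim: n => // n IH; rewrite expgS; exact: XM.
Qed.

(** Adjoining the pair [t] to the graph [X]. *)
Definition graph_adjoin X t : set AU :=
  fun u => exists m n v, X v /\ u * t ^+ n = v * t ^+ m.

Lemma graph_adjoinP X x z : char_graph X ->
  (forall n w, X (x ^+ n, w) -> w = z ^+ n) ->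
  char_graph (graph_adjoin X (x, z)).
Proof.
move=> [X1 XM XV X0] Hz; split.
- by exists 0%N, 0%N, 1.
- move=> u u' [m [n [v [Xv E]]]] [m' [n' [v' [Xv' E']]]].
  exists (m + m')%N, (n + n')%N, (v * v'); split; first exact: XM.
  by rewrite !expgnDr AUC4 E E' AUC4.
- move=> u [m [n [v [Xv E]]]]; exists n, m, v^-1; split; first exact: XV.
  apply: (@mulgI _ (u * v)).
  by rewrite [LHS]AUC4 (AUC u v) [RHS]AUC4 !mulgV !mul1g E.
- move=> w [m [n [v [Xv E]]]].
  case: (leqP m n) => mn.
    move: E; rewrite -(subnK mn) expgnDr mulgA => /mulIg; rewrite pairX.
    case: v Xv => v1 v2 Xv [E1 E2]; move: Xv; rewrite -E1 -E2 mul1g => /Hz.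
    by rewrite -[RHS]mul1g => /mulIg.
  move: E; rewrite -(subnK (ltnW mn)) expgnDr mulgA => /mulIg; rewrite pairX.
  case: v Xv => v1 v2 /XV Xv [E1 E2]; move: Xv.
  have -> : (v1, v2)^-1 = (x ^+ (m - n), w^-1 * z ^+ (m - n)) :> AU.
    congr (_, _); first by apply: mulg1_eq.
    by rewrite E2 invgM mgroupC mulVKg.
  by move=> /Hz; rewrite -[RHS]mul1g => /mulIg /(congr1 inv); rewrite invgK invg1.
Qed.

Lemma graph_adjoin_sub X t u : X u -> graph_adjoin X t u.
Proof. by exists 0%N, 0%N, u. Qed.

Lemma graph_adjoin_in X t : char_graph X -> graph_adjoin X t t.
Proof. by case=> X1 _ _ _; exists 1%N, 0%N, 1; rewrite mulg1 mul1g. Qed.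

(** A value at [x] compatible with the character of graph [X]: if k generates
    the exponents n such that x^n is in its domain, take a k-th root of its
    value at x^k. *)
Lemma graph_value X x : char_graph X ->
  exists z, forall n w, X (x ^+ n, w) -> w = z ^+ n.
Proof.
move=> gX; have [X1 XM XV X0] := gX.
have [|m n [w Xw] [w' Xw']|m n [w Xw] [w' Xw']|k [w Xk] Hk] :=
    @nat_subgroup_dvd (fun n => exists w, X (x ^+ n, w)).
- by exists 1.
- by exists (w * w'); rewrite expgnDr; exact: XM _ _ Xw Xw'.
- exists (w * w'^-1); have := XM _ _ Xw (XV _ Xw'); congr X; congr (_, _).
  by rewrite expgnDr AC mulKg.
have [z zk] : exists z, z ^+ k = w.
  case: (posnP k) Xk => [-> Xk|k0 _]; last exact: mgroup_root.
  by exists 1; rewrite (X0 w).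
exists z => n w' Xn; have /dvdnP[q E] := Hk n (ex_intro _ w' Xn).
apply: (graph_fun gX Xn); rewrite E mulnC !expgnA zk -pairX.
exact: graphX.
Qed.

Lemma char_separates (b : A) : b != 1 ->
  exists chi : {hom A -> U}, chi b != 1.
Proof.
move=> b1.
have gX1 : char_graph (fun u => u = 1).
  by split=> [//|u v -> ->|u ->|w [//]]; rewrite ?mulg1 ?invg1.
have [z Hz z1] : exists2 z : U,
    forall n w, (b ^+ n, w) = 1 :> AU -> w = z ^+ n & z != 1.
  have [||m n|k Pk Hk] := @nat_subgroup_dvd (fun n => b ^+ n = 1) => //.
  - by move=> m n; rewrite expgnDr => -> ->; rewrite mulg1.
  - by rewrite expgnDr => + E; rewrite E mul1g.
  have k1 : k != 1%N by apply: contra_neq b1 => k1; rewrite -Pk k1.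
  have [z zk z1] := mgroup_unity_root K k1; exists z => // n w [/Hk].
  by move=> /dvdnP[q ->] ->; rewrite mulnC expgnA zk expg1n.
(* The empty set is admitted in P, being the union of the empty chain. *)
pose P : set (set AU) := fun X => (exists u, X u) -> char_graph X /\ X (b, z).
have [|X [PX Xmax]] := @Zorn_bigcup AU P.
  move=> F FP Ftot [u [X0 FX0 X0u]].
  have gF X : F X -> (exists v, X v) -> char_graph X /\ X (b, z).
    by move=> FX; exact: FP.
  have [[X01 _ _ _] X0b] := gF _ FX0 (ex_intro _ _ X0u).
  split; last by exists X0.
  split; first by exists X0.
  - move=> v v' [X FX Xv] [X' FX' Xv'].
    have [[_ XM _ _] _] := gF _ FX (ex_intro _ _ Xv).
    have [[_ XM' _ _] _] := gF _ FX' (ex_intro _ _ Xv').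
    case: (Ftot _ _ FX FX') => s; [exists X'|exists X] => //.
      by apply: XM' => //; exact: s.
    by apply: XM => //; exact: s.
  - move=> v [X FX Xv]; have [[_ _ XV _] _] := gF _ FX (ex_intro _ _ Xv).
    by exists X => //; exact: XV.
  - move=> w [X FX Xw]; have [[_ _ _ X1] _] := gF _ FX (ex_intro _ _ Xw).
    exact: X1.
have [u Xu] : exists u, X u.
  apply: contrapT => nX.
  have gX := graph_adjoinP gX1 Hz.
  apply: (Xmax (graph_adjoin (fun u => u = 1) (b, z))).
    split=> [u Xu|/(_ (b, z))]; first by case: nX; exists u.
    by move=> /(_ (graph_adjoin_in _ gX1)) Xb; case: nX; exists (b, z).
  by move=> _; split=> //; exact: graph_adjoin_in.
have [gX Xb] := PX (ex_intro _ _ Xu).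
have dX a : exists w, X (a, w).
  have [w Hw] := graph_value a gX; exists w; apply: contrapT => nXa.
  apply: (Xmax (graph_adjoin X (a, w))).
    split=> [v|/(_ (a, w))]; first exact: graph_adjoin_sub.
    by move=> /(_ (graph_adjoin_in _ gX)).
  move=> _; split; first exact: graph_adjoinP.
  exact: graph_adjoin_sub.
have [f Hf] := choice dX.
have fM : {morph f : x y / x * y}.
  move=> x y; apply: (graph_fun gX (Hf _)).
  by case: gX => _ XM _ _; exact: XM _ _ (Hf x) (Hf y).
by exists (mkhom fM); rewrite //= (graph_fun gX (Hf b) Xb).
Qed.

End Separation.

(** * The multiplier of a presentation is bounded by the second cohomology *)

(** Independence of characters: distinct multiplicative functions that do not
    vanish identically are linearly independent. *)
Lemma dedekind_independence (K : fieldType) (T : Type) (op : T -> T -> T)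
    (P : T -> Prop) (x0 : T) (I : eqType) (e : I -> T -> K) :
  P x0 -> (forall i, e i x0 != 0%R) ->
  (forall x y, P x -> P y -> P (op x y)) ->
  (forall i x y, e i (op x y) = (e i x * e i y)%R) ->
  forall (s : seq I) (c : I -> K), uniq s ->
    (forall i j, i \in s -> j \in s -> i != j ->
       exists2 x, P x & e i x != e j x) ->
    (forall x, P x -> (\sum_(i <- s) c i * e i x = 0)%R) ->
    forall i, i \in s -> c i = 0%R.
Proof.
move=> Px0 ex0 PM eM; elim=> // i0 s IH c /= /andP[i0s us] sep Hc.
have c0 j : j \in s -> c j = 0%R.
  move=> js; have [x1 Px1 d] : exists2 x, P x & e j x != e i0 x.
    by apply: sep; rewrite ?inE ?js ?eqxx ?orbT //; apply: contraNneq i0s => <-.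
  (* Subtract e_i0(x1) times the relation at x from the relation at x1 x: this
     is a relation without e_i0, with coefficients c_j (e_j(x1) - e_i0(x1)). *)
  have := IH (fun j => c j * (e j x1 - e i0 x1))%R us.
  move=> /(_ _ _ j js) H; have {H} : (c j * (e j x1 - e i0 x1) = 0)%R.
    apply: H => [i k si sk|x Px]; first by apply: sep; rewrite inE ?si ?sk orbT.
    have := Hc x Px; have := Hc _ (PM _ _ Px1 Px).
    rewrite !big_cons eM => H1 H2.
    transitivity (\sum_(j <- s) c j * e j (op x1 x)
                  - e i0 x1 * \sum_(j <- s) c j * e j x)%R.
      rewrite GRing.mulr_sumr -GRing.sumrB; apply: eq_bigr => k _.
      rewrite eM GRing.mulrBr GRing.mulrBl GRing.mulrA; congr (_ - _)%R.
      by rewrite GRing.mulrCA GRing.mulrA.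
    move/eqP: H1; rewrite GRing.addrC GRing.addr_eq0 => /eqP ->.
    move/eqP: H2; rewrite GRing.addrC GRing.addr_eq0 => /eqP ->.
    by rewrite GRing.mulrN GRing.opprK GRing.mulrCA GRing.addrC GRing.subrr.
  by move/eqP; rewrite GRing.mulf_eq0 GRing.subr_eq0 (negPf d) orbF => /eqP.
move=> i; rewrite inE => /orP[/eqP ->|]; last exact: c0.
have := Hc x0 Px0; rewrite big_cons big_seq big1 ?GRing.addr0.
  by move/eqP; rewrite GRing.mulf_eq0 (negPf (ex0 i0)) orbF => /eqP.
by move=> j /c0 ->; rewrite GRing.mul0r.
Qed.

(** The subgroup [N, F] generated by the commutators of [N] with the whole
    group. *)
Definition relcomm_gens (F : groupType) (N : {pred F}) : {pred F} :=
  fun z => `[< exists x y, x \in N /\ z = [~ x, y] >].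
Definition relcomm (F : groupType) (N : {pred F}) : {pred F} :=
  gen (relcomm_gens N).
HB.instance Definition _ (F : groupType) (N : {pred F}) :=
  GroupClosed.on (relcomm N).

Lemma mem_relcomm (F : groupType) (N : {pred F}) x y :
  x \in N -> [~ x, y] \in relcomm N.
Proof. by move=> Nx; apply/mem_gen/asboolP; exists x, y. Qed.

Lemma relcomm_normal (F : groupType) (N : {pred F}) :
  normalp N -> normalp (relcomm N).
Proof.
move=> nN x y; apply: gen_conj => _ /asboolP[a [b [Na ->]]].
by rewrite conjRg mem_relcomm // nN.
Qed.

Section Cohomology.
Variables (K : numClosedFieldType) (G : finGroupType).
Local Notation U := (mgroup K).
Local Notation cochain := {ffun G * G -> U}.

HB.instance Definition _ := SemiGroup.isCommutativeLaw.Build U (@mul U)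
  (@mgroupC K).

Lemma B2_div (f g : cochain) :
  f \in B2 (G := G) (K := K) -> g \in B2 (G := G) (K := K) ->
  f * g^-1 \in B2 (G := G) (K := K).
Proof.
move=> /asboolP[c Hc] /asboolP[d Hd]; apply/asboolP; exists (c * d^-1) => x y.
by rewrite !ffunE Hc Hd !mgroupVM [LHS]mgroupM4 [in RHS](mgroupM4 (c x)).

Qed.

Lemma unity_roots_seq n : (0 < n)%N ->
  exists r : seq U, forall z, z ^+ n = 1 -> z \in r.
Proof.
move=> n0.
have [r Hr] := closed_field_poly_normal ('X^n - 1 : {poly K})%R.
exists (pmap insub r) => z zn; rewrite mem_pmap; apply/mapP; exists (val z).
  have : root ('X^n - 1 : {poly K})%R (val z).
    by rewrite /root !hornerE -val_mgroupX zn /= GRing.subrr.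
  rewrite Hr rootZ ?root_prod_XsubC //.
  by rewrite lead_coef_eq0 -size_poly_eq0 size_XnsubC.
by rewrite valK.
Qed.

(** The second cohomology group is finite: |G|-th powers of cocycles are
    coboundaries, so each class contains a cocycle whose values are |G|-th
    roots of unity. *)
Lemma H2_finite : exists zs : seq cochain, forall f, f \in Z2 (G := G) (K := K) ->
  exists2 z, z \in zs & f^-1 * z \in B2 (G := G) (K := K).
Proof.
pose n := #|G|; have n0 : (0 < n)%N by apply/card_gt0P; exists 1.
have [r Hr] := unity_roots_seq n0.
exists [seq [ffun u => nth 1 r (g u)] | g : {ffun G * G -> 'I_(size r).+1}].
move=> f /asboolP fZ.
pose c x : U := \prod_(z : G) f (x, z).
(* Multiply the cocycle identity over its last variable. *)
have fn x y : f (x, y) ^+ n = c x * c y * (c (x * y))^-1.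
  have E : \prod_(z : G) (f (x, y) * f (x * y, z))
      = \prod_(z : G) (f (y, z) * f (x, y * z)).
    by apply: eq_bigr => z _; exact: fZ.
  have cxy : c x = \prod_(z : G) f (x, y * z) by exact: (reindex_inj (mulgI y)).
  move: E; rewrite !big_split /= -cxy prodg_const => E.
  apply: (@mulIg _ (c (x * y))); rewrite mulgVK (mgroupC (c x)) -E.
  by [].
pose d x : U := projT1 (cid (mgroup_root (c x) n0)).
have dn x : d x ^+ n = c x by rewrite /d; case: cid.
pose g x y := f (x, y) / (d x * d y * (d (x * y))^-1).
have gr x y : g x y \in r.
  apply: Hr; rewrite /g expgMn; last exact: mgroup_commute.
  rewrite expVgn !expgMn ?expVgn ?dn; try exact: mgroup_commute.
  by rewrite fn mulgV.
exists [ffun u => g u.1 u.2]; last first.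
  apply/asboolP; exists [ffun x => (d x)^-1] => x y.
  by rewrite !ffunE /g mulKg !mgroupVM.
apply/mapP; exists [ffun u => inord (index (g u.1 u.2) r)].
  exact: mem_enum.
apply/ffunP => -[x y]; rewrite !ffunE inordK ?nth_index //.
by rewrite ltnS index_size.
Qed.

End Cohomology.

Section Transgression.
Variables (K : numClosedFieldType) (G : finGroupType) (F : groupType).
Variables (pi : {hom F -> G}) (N : groupClosed F).
Hypothesis piS : forall x, exists f, pi f = x.
Hypothesis piK : forall f, (f \in N) = (pi f == 1).
Local Notation U := (mgroup K).
Local Notation cochain := {ffun G * G -> U}.
Implicit Types (chi : F -> U) (f g : F).

Lemma kernel_normal : normalp N.
Proof. by move=> x y; rewrite !piK gmulfJ => /eqP ->; rewrite conj1g. Qed.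

(** Invariant characters of [N], given by their values on the whole group;
    those outside of [N] are irrelevant. *)
Definition inv_char chi : Prop :=
  (forall x y, x \in N -> y \in N -> chi (x * y) = chi x * chi y) /\
  (forall x y, x \in N -> chi (x ^ y) = chi x).

Lemma inv_char_separates b : b \in N -> b \notin relcomm N ->
  exists2 chi, inv_char chi & chi b != 1.
Proof.
move=> Nb nLb; have nL := relcomm_normal kernel_normal.
pose A := sect N (relcomm N).
pose q (u : sgroup N) : A := piq (restr (S := N) (relcomm N)) u.
have qM : {morph q : u v / u * v} by move=> u v; rewrite /q gmulfM.
have qE u v : (val u)^-1 * val v \in relcomm N -> q u = q v.
  by move=> H; apply/piqP; rewrite restr_ncl // gmulfM gmulfV.
have AC (x y : A) : x * y = y * x.
  have [u <-] := piq_surj x; have [v <-] := piq_surj y.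
  rewrite -[LHS](qM u v) -[RHS](qM v u); apply: qE; rewrite !gmulfM invgM -mulgA.
  exact/mem_relcomm/valP.
pose inN f : sgroup N := insubd 1 f.
have inNK f : f \in N -> val (inN f) = f by exact: insubdK.
have qb1 : q (inN b) != 1.
  by apply: contraNneq nLb => /(sect_eq1 _ nL); rewrite inNK.
have [chi chib] := char_separates K AC qb1.
exists (fun f => chi (q (inN f))) => //; split=> [x y Nx Ny|x y Nx].
  rewrite -gmulfM -qM; congr (chi (q _)); apply/val_inj.
  by rewrite [RHS]valM !inNK // gpredM.
congr (chi _); apply: qE; rewrite !inNK // ?kernel_normal //.
by rewrite -gpredV invgM invgK -commgEl mem_relcomm.
Qed.

Let sec : G -> F := projT1 (choice piS).
Let secK x : pi (sec x) = x.
Proof. exact: (projT2 (choice piS)). Qed.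

Let psi chi f : U := chi (f * (sec (pi f))^-1).

(** The transgression of an invariant character of [N]: its value on the factor
    set s(x) s(y) s(xy)^-1 of the section s = [sec]. *)
Definition trg chi : cochain := [ffun u => psi chi (sec u.1 * sec u.2)].

Let NV f : f * (sec (pi f))^-1 \in N.
Proof. by rewrite piK gmulfM gmulfV secK mulgV. Qed.

Let chi1 chi : inv_char chi -> chi 1 = 1.
Proof.
by case=> cM _; apply: (@mulgI _ (chi 1)); rewrite -cM ?gpred1 // !mulg1.
Qed.

Let psi_sec chi x : inv_char chi -> psi chi (sec x) = 1.
Proof. by move=> Hc; rewrite /psi secK mulgV chi1. Qed.

Let psiM chi f g : inv_char chi ->
  psi chi (f * g) = psi chi f * psi chi g * trg chi (pi f, pi g).
Proof.
move=> [cM cJ]; rewrite /trg ffunE /psi /= !gmulfM !secK.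
set x := sec (pi f); set y := sec (pi g); set z := sec _.
have Nt : x * y * z^-1 \in N.
  by rewrite piK gmulfM gmulfV gmulfM !secK mulgV.
have Nf : f * x^-1 \in N by exact: NV.
have Ng : g * y^-1 \in N by exact: NV.
have Ng' : (g * y^-1) ^ x^-1 \in N by exact: kernel_normal.
have Nfg := gpredM _ _ Nf Ng'.
rewrite -(cJ (g * y^-1) x^-1) // -cM // -cM //.
by congr chi; rewrite conjgE invgK -!mulgA !mulKg.
Qed.

Lemma trg_Z2 chi : inv_char chi -> trg chi \in Z2 (G := G) (K := K).
Proof.
move=> Hc; apply/asboolP => x y z.
have := psiM (sec x) (sec y * sec z) Hc.
rewrite mulgA !(psiM (sec x * sec y)) // !(psiM _ (sec _)) // !gmulfM !secK.
by rewrite !psi_sec // !(mul1g, mulg1).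
Qed.

(** A character whose transgression is a coboundary extends to a homomorphism
    on [F], which is trivial on the derived subgroup. *)
Lemma trg_trivial chi b : inv_char chi -> trg chi \in B2 (G := G) (K := K) ->
  b \in N -> b \in der (fullg F) -> chi b = 1.
Proof.
move=> Hc /asboolP[c Hcb] Nb Db; have [cM _] := Hc.
(* Up to a constant, h extends chi. *)
pose h f := psi chi f * c (pi f).
have hM : {morph h : f g / f * g}.
  move=> f g; rewrite /h psiM // Hcb gmulfM.
  by rewrite -[LHS]mulgA mulgVK mgroupM4.
have h1 f : f \in der (fullg F) -> h f = 1.
  by apply: (morph_der1 (f := mkhom hM)) => u v _ _; exact: mgroupC.
have : h b = h 1 by rewrite !h1 ?gpred1.
rewrite /h /psi gmulf1; have -> : pi b = 1 by apply/eqP; rewrite -piK.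
have s1 : sec 1 \in N by rewrite piK secK.
move=> /mulIg E; apply: (@mulIg _ (chi ((sec 1)^-1))).
by rewrite -cM ?gpredV // E !mul1g.
Qed.

Lemma inv_char_mulV chi chi' : inv_char chi -> inv_char chi' ->
  inv_char (fun f => chi f * (chi' f)^-1).
Proof.
move=> [cM cJ] [cM' cJ']; split=> [x y Nx Ny|x y Nx]; last by rewrite cJ // cJ'.
by rewrite cM // cM' // mgroupVM mgroupM4.
Qed.

Lemma inv_char_mul chi chi' : inv_char chi -> inv_char chi' ->
  inv_char (fun f => chi f * chi' f).
Proof.
move=> [cM cJ] [cM' cJ']; split=> [x y Nx Ny|x y Nx]; last by rewrite cJ // cJ'.
by rewrite cM // cM' // mgroupM4.
Qed.

(** Elements of [N] in the derived subgroup of [F] that are distinct modulo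
    [N, F] are no more than the classes of cocycles: their evaluations are
    distinct characters of the group of invariant characters of [N], and they
    only depend on the class of the transgression. *)
Lemma card_multiplier_le (zs : seq cochain) (m : nat) (b : 'I_m -> F) :
  (forall f : cochain, f \in Z2 (G := G) (K := K) ->
     exists2 z, z \in zs & f^-1 * z \in B2 (G := G) (K := K)) ->
  (forall i, b i \in N) -> (forall i, b i \in der (fullg F)) ->
  (forall i j, (b i)^-1 * b j \in relcomm N -> i = j) ->
  (m <= size zs)%N.
Proof.
move=> Hzs Nb Db bI; rewrite leqNgt; apply/negP => lt_m.
have one_char : inv_char (fun=> 1) by split=> *; rewrite ?mulg1.
pose R chi (k : 'I_(size zs)) :=
  inv_char chi /\ (trg chi)^-1 * tnth (in_tuple zs) k \in B2 (G := G) (K := K).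
(* For each cochain of zs, an invariant character with cohomologous
   transgression, if there is one. *)
have /choice[ch Hch] : forall k, exists chi, inv_char chi /\
    forall chi', R chi' k -> R chi k.
  move=> k; have [[chi Hchi]|nR] := pselect (exists chi, R chi k).
    by exists chi; split; [case: Hchi|].
  by exists (fun=> 1); split=> // chi' HR; case: nR; exists chi'.
pose A : 'M[K]_(m, size zs) := (\matrix_(i, k) val (ch k (b i)))%R.
(* The matrix A has more rows than columns, so its rows are dependent. *)
have [v v0 vA] : exists2 v : 'rV[K]_m, (v != 0)%R & (v *m A = 0)%R.
  have : kermx A != 0%R.
    rewrite kermx_eq0 /row_free; apply: contraTneq lt_m => <-.
    by rewrite -leqNgt rank_leq_col.
  by case/rowV0Pn => v /sub_kermxP vA v0; exists v.
(* On the b_i every invariant character agrees with one of the ch_k, so the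
   relation between the rows of A is one between evaluations. *)
have Hsum chi : inv_char chi -> (\sum_i v 0%R i * val (chi (b i)) = 0)%R.
  move=> Hc; have [z /seq_tnthP[k ->] HB] := Hzs _ (trg_Z2 Hc).
  have [Hk /(_ chi (conj Hc HB))[_ HB']] := Hch k.
  have E i : chi (b i) = ch k (b i).
    apply: esym; apply: divg1_eq.
    apply: (@trg_trivial (fun f => ch k f * (chi f)^-1) (b i)) => //.
      exact: inv_char_mulV.
    have := B2_div HB HB'; rewrite invgM invgK mulgA mulgK.
    suff -> : (trg chi)^-1 * trg (ch k) = trg (fun f => ch k f * (chi f)^-1) by [].
    by apply/ffunP => u; rewrite !ffunE /psi mgroupC.
  have := congr1 (fun w : 'rV[K]_(size zs) => w 0%R k) vA; rewrite !mxE.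
  by apply: etrans; apply: eq_bigr => i _; rewrite !mxE E.
case/rV0Pn: v0 => i /eqP; apply.
apply: (@dedekind_independence K (F -> U) (fun c d f => c f * d f) inv_char
  (fun=> 1) 'I_m (fun i chi => val (chi (b i))) _ _ _ _ (index_enum _) (v 0%R)).
- by [].
- by move=> j; exact: (valP (1 : U)).
- exact: inv_char_mul.
- by [].
- exact: index_enum_uniq.
- move=> j k _ _ jk.
  have [||chi Hc n1] := @inv_char_separates ((b j)^-1 * b k).
  + by rewrite gpredM ?gpredV.
  + by apply: contraNN jk => /bI ->.
  exists chi => //; apply: contraNneq n1 => /val_inj E.
  have [cM _] := Hc; apply/eqP; apply: (@mulgI _ (chi (b j))).
  by rewrite -cM ?gpredM ?gpredV // mulVKg mulg1.
- exact: Hsum.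
- exact: mem_index_enum.
Qed.

End Transgression.

Section MultiplierKernel.
Variables (K : numClosedFieldType) (G : finGroupType) (F H : groupType).
Variables (pi : {hom F -> G}) (N : groupClosed F).
Hypothesis piS : forall x, exists f, pi f = x.
Hypothesis piK : forall f, (f \in N) = (pi f == 1).
Local Notation U := (mgroup K).
Local Notation cochain := {ffun G * G -> U}.
Local Notation Z2K := (Z2 (G := G) (K := K)).
Local Notation B2K := (B2 (G := G) (K := K)).

Lemma B2_one : (1 : cochain) \in B2K.
Proof.
by apply/asboolP; exists 1 => x y; rewrite !ffunE invg1 !mulg1.
Qed.

Lemma B2_inv (f : cochain) : f \in B2K -> f^-1 \in B2K.
Proof. by move=> Bf; rewrite -[f^-1]mul1g B2_div ?B2_one. Qed.

Lemma ncl_restr_B2 (u : sgroup Z2K) : u \in ncl (restr (S := Z2K) B2K) ->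
  val u \in B2K.
Proof.
move: u; apply: ncl_ind => // [|u v|u|u v].
- by rewrite val1 B2_one.
- by rewrite valM => Bu Bv; rewrite -(invgK (val v)) B2_div ?B2_inv.
- by rewrite gmulfV => /B2_inv.
- rewrite gmulfJ; suff -> : val u ^ val v = val u by [].
  by apply/ffunP => x; rewrite !ffunE mgroupC mulgK.
Qed.

(** Hopf's formula, as far as needed: a homomorphism from [F] that kills
    [N, F] and maps N /\ F' onto a group isomorphic to the multiplier is
    injective on N /\ F' modulo [N, F], by a comparison of cardinals. *)
Lemma multiplier_kernel (M : groupClosed H) (q : {hom F -> H}) :
  isog (sgroup M) (H2 G K) ->
  (forall m, m \in M ->
     exists b, [/\ b \in N, b \in der (fullg F) & q b = m]) ->
  (forall x, x \in relcomm N -> q x = 1) ->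
  forall c, c \in N -> c \in der (fullg F) -> q c = 1 -> c \in relcomm N.
Proof.
move=> [e [e' eK e'K]] qM qL c Nc Dc qc; apply: contraT => nLc.
have [zs Hzs] := H2_finite K G.
pose cls (z : cochain) : H2 G K := piq (restr (S := Z2K) B2K) (insubd 1 z).
pose hs := undup (map cls zs).
have hsP h : h \in hs.
  have [u <-] := piq_surj h; have [z zs_z Bz] := Hzs _ (valP u).
  rewrite mem_undup; apply/mapP; exists z => //; apply/piqP/mem_ncl.
  have Zz : z \in Z2K.
    by rewrite -(mulVKg (val u) z) gpredM ?(valP u) // B2_sub.
  have E : val (insubd (1 : sgroup Z2K) z) = z by exact: insubdK.
  by rewrite unfold_in gmulfM gmulfV /= E.
pose ms := map e' hs.
have us : uniq ms by rewrite map_inj_uniq ?undup_uniq //; exact: can_inj e'K.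
pose zs' := [seq val (repr h) | h : H2 G K <- hs].
have Hzs' (f : cochain) : f \in Z2K -> exists2 z, z \in zs' & f^-1 * z \in B2K.
  move=> Zf; pose u : sgroup Z2K := exist (fun f => f \in Z2K) f Zf.
  pose h : H2 G K := piq (restr (S := Z2K) B2K) u.
  exists (val (repr h)); first by apply/mapP; exists h.
  have /piqP/ncl_restr_B2 : h = piq (restr (S := Z2K) B2K) (repr h).
    by rewrite reprqK.
  by rewrite gmulfM gmulfV.
have [b Hb] := choice (fun m : sgroup M => qM _ (valP m)).
(* One preimage of each element of M, and a further element of N /\ F' that is
   distinct from them modulo [N, F]. *)
pose bb (i : 'I_(size ms).+1) :=
  if unlift ord0 i is Some j then b (tnth (in_tuple ms) j) else b 1 * c.
have Hbb i : bb i \in N /\ bb i \in der (fullg F).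
  rewrite /bb; case: unliftP => [j _|_]; first by case: (Hb (tnth (in_tuple ms) j)).
  by case: (Hb 1) => N1 D1 _; rewrite !gpredM.
suff /(card_multiplier_le piS piK Hzs' (fun i => (Hbb i).1) (fun i => (Hbb i).2)) :
    forall i j, (bb i)^-1 * bb j \in relcomm N -> i = j.
  by rewrite !size_map ltnn.
have qb m : q (b m) = val m by case: (Hb m).
have sym i j : (bb i)^-1 * bb j \in relcomm N -> (bb j)^-1 * bb i \in relcomm N.
  by rewrite -gpredV invgM invgK.
have one i j : unlift ord0 i = None -> unlift ord0 j <> None ->
    (bb i)^-1 * bb j \in relcomm N -> i = j.
  rewrite /bb => ->; case: unliftP => // k _ _ Lij.
  have := qL _ Lij; rewrite gmulfM gmulfV gmulfM !qb qc val1 !mul1g invg1 mul1g.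
  move=> m1; move: Lij nLc.
  have -> : tnth (in_tuple ms) k = 1 by apply/val_inj; rewrite m1.
  by rewrite invgM mulgVK gpredV => ->.
move=> i j; case Ei: (unlift ord0 i) => [i'|]; case Ej: (unlift ord0 j) => [j'|].
- rewrite /bb Ei Ej => /qL; rewrite gmulfM gmulfV !qb => /mulg1_eq.
  rewrite invgK => /val_inj /eqP; rewrite !(tnth_nth 1) nth_uniq //.
  move=> /eqP/val_inj E; move: Ei Ej.
  by case: unliftP => // k -> [->]; case: unliftP => // l -> [->]; rewrite E.
- by move=> /sym Lji; apply/esym/one => //; rewrite Ei.
- by apply: one => //; rewrite Ej.
- by move: Ei Ej; case: unliftP => // ->; case: unliftP => // ->.
Qed.

End MultiplierKernel.

(** * The groups tau(G) and T(H)/T(M) *)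

Section TauT.
Variables (G H F : groupType) (p : {hom H -> G}) (q : {hom F -> H}).
Variables (M : groupClosed H) (N : groupClosed F).
Hypothesis pS : forall x, exists h, p h = x.
Hypothesis pK : forall h, (h \in M) = (p h == 1).
Hypothesis cM : {subset M <= center H}.
Hypothesis qS : forall h, exists f, q f = h.
Hypothesis qN : forall f, (f \in N) = (q f \in M).
Hypothesis qK : forall c, c \in der (fullg F) -> q c = 1 -> c \in relcomm N.

Local Notation HHH := (H * H * H)%type.
Local Notation TH := (Tset (fullg H)).
Implicit Types (u v w : HHH) (a b c : H).

Lemma center_der1 a : a \in der M -> a = 1.
Proof.
exact: (@morph_der1 H H M idfun a (fun b c Mb _ => centerC c (cM Mb))).
Qed.

Lemma TH_mem a b c : ((a, b, c) \in TH) = (c^-1 * (a * b) \in der (fullg H)).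
Proof. by apply/TsetP/idP => [[]|]. Qed.

Lemma TM_mem a b c : (a, b, c) \in Tset M <-> [/\ a \in M, b \in M & c = a * b].
Proof.
split=> [/TsetP[/= Ma Mb Mc /center_der1 E]|[Ma Mb ->]].
  by split=> //; rewrite -(mulg1_eq E) invgK.
by apply/TsetP; split=> //=; [exact: gpredM|rewrite mulVg gpred1].
Qed.

(** The class of an element of T(H) modulo T(M). *)
Definition tq u : TquotT M := piq (restr (S := TH) (Tset M)) (insubd 1 u).

Let inTK u : u \in TH -> val (insubd (1 : sgroup TH) u) = u.
Proof. exact: insubdK. Qed.

Lemma tq_val (s : sgroup TH) : tq (val s) = piq (restr (S := TH) (Tset M)) s.
Proof. by congr piq; apply/val_inj; rewrite inTK ?(valP s). Qed.

Lemma tq_surj (y : TquotT M) : exists2 u, u \in TH & tq u = y.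
Proof.
by have [s <-] := piq_surj y; exists (val s); rewrite ?(valP s) ?tq_val.
Qed.

Lemma tqM u v : u \in TH -> v \in TH -> tq (u * v) = tq u * tq v.
Proof.
move=> Tu Tv; rewrite -gmulfM; congr piq; apply/val_inj.
by rewrite [RHS]valM !inTK // gpredM.
Qed.

Lemma tq_eq1 u : u \in TH -> tq u = 1 <-> u \in Tset M.
Proof.
move=> Tu; have := sect_eq1 (insubd (1 : sgroup TH) u) (Tset_normal cM).
by rewrite inTK.
Qed.

Lemma tqV u : u \in TH -> tq u^-1 = (tq u)^-1.
Proof.
move=> Tu; apply/esym/mulg1_eq; rewrite -tqM ?gpredV // mulgV.
by apply/tq_eq1; rewrite ?gpred1.
Qed.

Lemma tqJ u v : u \in TH -> v \in TH -> tq (u ^ v) = tq u ^ tq v.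
Proof. by move=> Tu Tv; rewrite !tqM ?gpredM ?gpredV // tqV. Qed.

Lemma tqR u v : u \in TH -> v \in TH -> tq [~ u, v] = [~ tq u, tq v].
Proof.
by move=> Tu Tv; rewrite commgEl tqM ?gpredJ ?gpredV // tqV // tqJ.
Qed.

Lemma TH1 a : (a, 1, a) \in TH.
Proof. by rewrite TH_mem mulg1 mulVg gpred1. Qed.
Lemma TH2 a : (1, a, a) \in TH.
Proof. by rewrite TH_mem mul1g mulVg gpred1. Qed.
Lemma TH3 c : c \in der (fullg H) -> (1, 1, c) \in TH.
Proof. by rewrite TH_mem !mulg1 gpredV. Qed.

Lemma tq_fst : exists i : {hom G -> TquotT M}, forall a, i (p a) = tq (a, 1, a).
Proof.
have fM : {morph (fun a => tq (a, 1, a)) : a b / a * b}.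
  by move=> a b; rewrite -tqM ?TH1 //; congr tq; congr (_, _, _); rewrite mulg1.
apply: (@hom_factor _ _ _ p (mkhom fM)) => // a /eqP; rewrite -pK => Ma.
by apply/tq_eq1; [exact: TH1|apply/TM_mem; rewrite gpred1 mulg1].
Qed.

Lemma tq_snd : exists j : {hom G -> TquotT M}, forall a, j (p a) = tq (1, a, a).
Proof.
have fM : {morph (fun a => tq (1, a, a)) : a b / a * b}.
  by move=> a b; rewrite -tqM ?TH2 //; congr tq; congr (_, _, _); rewrite mulg1.
apply: (@hom_factor _ _ _ p (mkhom fM)) => // a /eqP; rewrite -pK => Ma.
by apply/tq_eq1; [exact: TH2|apply/TM_mem; rewrite gpred1 mul1g].
Qed.

Lemma tq_comm a b : [~ tq (a, 1, a), tq (1, b, b)] = tq (1, 1, [~ a, b]).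
Proof.
rewrite -tqR ?TH1 ?TH2 //; congr tq; apply: (f_equal2 pair) => //.
by apply: (f_equal2 pair); [exact: commg1|exact: comm1g].
Qed.

Lemma tau_to_T : exists k : {hom tau G -> TquotT M},
  (forall a, k (tau_in G (p a)) = tq (a, 1, a)) /\
  (forall a, k (tau_star G (p a)) = tq (1, a, a)).
Proof.
have [i iE] := tq_fst; have [j jE] := tq_snd.
have Hc a b c : tq (1, 1, [~ a, b]) ^ tq (c, 1, c) = tq (1, 1, [~ a ^ c, b ^ c]).
  rewrite -tqJ ?TH1 ?TH3 ?mem_commg_der //; congr tq; rewrite -conjRg.
  by apply: (f_equal2 pair) => //; apply: (f_equal2 pair); exact: conj1g.
have Hc' a b c : tq (1, 1, [~ a, b]) ^ tq (1, c, c) = tq (1, 1, [~ a ^ c, b ^ c]).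
  rewrite -tqJ ?TH2 ?TH3 ?mem_commg_der //; congr tq; rewrite -conjRg.
  by apply: (f_equal2 pair) => //; apply: (f_equal2 pair); exact: conj1g.
have [x y z|x y z|x|k [ki kj]] := @tau_lift G _ i j.
- have [a <-] := pS x; have [b <-] := pS y; have [c <-] := pS z.
  by rewrite -!gmulfJ !iE !jE !tq_comm Hc.
- have [a <-] := pS x; have [b <-] := pS y; have [c <-] := pS z.
  by rewrite -!gmulfJ !iE !jE !tq_comm Hc'.
- have [a <-] := pS x; rewrite iE jE tq_comm commgg.
  by apply/tq_eq1; rewrite ?gpred1.
by exists k; split=> a; rewrite ?ki ?kj.
Qed.

(** In tau(G), elements of the two copies of [G] commute up to the exterior
    square. *)
Lemma tau_normal_form (t : tau G) : exists x y (w : wedge G),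
  t = tau_in G x * tau_star G y * val w.
Proof.
elim/tau_ind: t => [|x' _ [x [y [w ->]]]|y' _ [x [y [w ->]]]].
- by exists 1, 1, 1; rewrite !gmulf1 !mulg1.
- by exists (x' * x), y, w; rewrite gmulfM !mulgA.
- exists x, (y' * y), (wact (wd x y')^-1 y * w).
  have E : val (wact (wd x y')^-1 y)
      = [~ tau_star G y', tau_in G x] ^ tau_star G y.
    by rewrite -{1}(tau_bndj y) wactE -invgR -val_wd; congr (_ ^ _).
  have shuffle (X : groupType) (a b c d : X) :
      b * (a * c * d) = a * (b * c) * ([~ b, a] ^ c * d).
    by rewrite commgEl !conjgE -!mulgA !mulVKg.
  by rewrite shuffle gmulfM valM E.
Qed.

(** The homomorphism of [tau_to_T] is onto because T(H) is generated by the
    triples (a, 1, a), (1, b, b) and (1, 1, c) with c in H'; it is injective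
    because its restriction to the exterior square of [G] can be undone in a
    wedge cover receiving [F]. *)
Lemma tau_isog_T (C : wedge_cover G) (phi : {hom F -> wc_sort C}) :
  (forall f, wc_p C (phi f) = p (q f)) -> isog (tau G) (TquotT M).
Proof.
move=> pphi; have [k [ki kj]] := tau_to_T.
have phiL f : f \in relcomm N -> phi f = 1.
  move: f; apply: gen_ind => [|x y Hx Hy|x Hx|_ /asboolP[x [y [Nx ->]]]].
  - exact: gmulf1.
  - by rewrite gmulfM Hx Hy mulg1.
  - by rewrite gmulfV Hx invg1.
  - rewrite gmulfR wc_comm !pphi; move: Nx; rewrite qN pK => /eqP ->.
    by rewrite wd1g gmulf1.
(* Each w in the exterior square is the image under phi of a product of
   commutators of F, whose image in H gives the value of k at w. *)
have kW (w : wedge G) : exists2 f, f \in der (fullg F) &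
    phi f = wc_i C w /\ k (val w) = tq (1, 1, q f).
  elim/wedge_ind: w => [|u v [f Df [E1 E2]] [g Dg [E1' E2']]|u [f Df [E1 E2]]|x y].
  - exists 1; rewrite ?gpred1 // !gmulf1; split=> //.
    by apply/esym/tq_eq1; rewrite ?gpred1.
  - exists (f * g); rewrite ?gpredM // !gmulfM E1 E1' E2 E2'; split=> //.
    rewrite -tqM ?TH3 ?der_hom //; congr tq; congr (_, _, _); exact: mulg1.
  - exists f^-1; rewrite ?gpredV // !gmulfV E1 E2; split=> //.
    rewrite -tqV ?TH3 ?der_hom //; congr tq; congr (_, _, _); exact: invg1.
  - have [a <-] := pS x; have [f <-] := qS a.
    have [b <-] := pS y; have [g <-] := qS b.
    exists [~ f, g]; first exact: mem_commg_der.
    by rewrite gmulfR wc_comm !pphi val_wd !gmulfR ki kj tq_comm.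
have kD c : c \in der (fullg H) ->
    c \in der (fullg H) /\ exists t, k t = tq (1, 1, c).
  move: c; apply: gen_ind => [|x y [Dx [t Et]] [Dy [t' Et']]|x [Dx [t Et]]|].
  - split; first exact: gpred1.
    by exists 1; rewrite gmulf1; apply/esym/tq_eq1; rewrite ?gpred1.
  - split; first exact: gpredM.
    exists (t * t'); rewrite gmulfM Et Et' -tqM ?TH3 //; congr tq.
    by congr (_, _, _); exact: mulg1.
  - split; first by rewrite gpredV.
    exists t^-1; rewrite gmulfV Et -tqV ?TH3 //; congr tq.
    by congr (_, _, _); exact: invg1.
  - move=> _ /asboolP[x [y [_ _ ->]]]; split; first exact: mem_commg_der.
    by exists [~ tau_in G (p x), tau_star G (p y)]; rewrite gmulfR ki kj tq_comm.
have tq3 a b c : c \in der (fullg H) ->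
    tq (a, 1, a) * tq (1, b, b) * tq (1, 1, c) = tq (a, b, a * b * c).
  move=> Dc; rewrite -!tqM ?gpredM ?TH1 ?TH2 ?TH3 //; congr tq.
  by congr (_, _, _); rewrite /= ?mulg1 ?mul1g.
exists k; apply: inj_surj_bij => [|y].
  apply: gmulf_inj => t; have [x [y [w ->]]] := tau_normal_form t.
  have [a <-] := pS x; have [b <-] := pS y; have [f Df [E1 E2]] := kW w.
  rewrite !gmulfM ki kj E2 tq3 ?der_hom // => /tq_eq1 H1.
  have /H1/TM_mem[Ma Mb] : (a, b, a * b * q f) \in TH.
    by rewrite TH_mem invgM mulgVK gpredV der_hom.
  rewrite -[RHS]mulg1 => /mulgI/(qK Df)/phiL; rewrite E1 => w1.
  have -> : w = 1 by apply: (@wc_i_inj _ C); rewrite w1 gmulf1.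
  move: Ma Mb; rewrite !pK => /eqP -> /eqP ->.
  by rewrite !gmulf1 !mulg1.
have [[[a b] c] + <-] := tq_surj y; rewrite TH_mem => Tc.
have [Dc [t Et]] : (a * b)^-1 * c \in der (fullg H) /\
    exists t, k t = tq (1, 1, (a * b)^-1 * c).
  by apply: kD; rewrite -gpredV invgM invgK.
exists (tau_in G (p a) * tau_star G (p b) * t).
by rewrite !gmulfM ki kj Et tq3 // mulVKg.
Qed.

End TauT.

(** * The group K(F,3) modulo the normal closure of K(N,3) *)

Section Triples.
Variable X : groupType.
Implicit Types x y z : X.

(** The triple (x, y, z) as an element of X^3. *)
Definition triple x y z : {ffun 'I_3 -> X} :=
  [ffun k : 'I_3 => nth 1 [:: x; y; z] k].

Lemma tripleE (u : {ffun 'I_3 -> X}) : exists x y z, u = triple x y z.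
Proof.
exists (u (inord 0)), (u (inord 1)), (u (inord 2)); apply/ffunP => k.
rewrite ffunE; case: k => [[|[|[|//]]] Hk] /=; congr (u _);
  by apply/val_inj; rewrite /= inordK.
Qed.

Lemma tripleM x y z x' y' z' :
  triple x y z * triple x' y' z' = triple (x * x') (y * y') (z * z').
Proof. by apply/ffunP => -[[|[|[|//]]] Hk]; rewrite !ffunE. Qed.

Lemma tripleV x y z : (triple x y z)^-1 = triple x^-1 y^-1 z^-1.
Proof. by apply/ffunP => -[[|[|[|//]]] Hk]; rewrite !ffunE. Qed.

Lemma triple1 : triple 1 1 1 = 1.
Proof. by apply/ffunP => -[[|[|[|//]]] Hk]; rewrite !ffunE. Qed.

Lemma tripleJ x y z x' y' z' :
  triple x y z ^ triple x' y' z' = triple (x ^ x') (y ^ y') (z ^ z').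
Proof. by rewrite conjgE tripleV !tripleM. Qed.

Lemma triple_eval x y z : [/\ triple x y z (inord 0) = x,
  triple x y z (inord 1) = y & triple x y z (inord 2) = z].
Proof. by rewrite !ffunE !inordK. Qed.

Lemma Kset3P (S : {pred X}) x y z : (triple x y z \in Kset S 3) <->
  [/\ x \in S, y \in S, z \in S & x * y * z \in der S].
Proof.
have E : \prod_(k < 3) triple x y z k = x * y * z.
  by rewrite !big_ord_recl big_ord0 !ffunE /= mulg1 mulgA.
split=> [/asboolP[Hk]|[Sx Sy Sz Hd]].
  have [Ex Ey Ez] := triple_eval x y z.
  have := Hk (inord 0); have := Hk (inord 1); have := Hk (inord 2).
  by rewrite E Ex Ey Ez.
apply/asboolP; rewrite E; split=> // k; rewrite ffunE.
by case: k => [[|[|[|//]]] Hk].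
Qed.

End Triples.

(** A triple of elements of [N] is (x, y, (xy)^-1) (1, 1, xyz), where the first
    factor lies in K(N,3), and (1, 1, [n, f]) is
    the commutator of (n^-1, 1, n) with (1, 1, f). *)
Lemma relcomm_triple (F : groupType) (N : groupClosed F) x y z :
  x \in N -> y \in N -> z \in N -> x * y * z \in relcomm N ->
  triple x y z \in ncl (Kset N 3).
Proof.
move=> Nx Ny Nz Hc.
have Hd c : c \in relcomm N -> triple 1 1 c \in ncl (Kset N 3).
  move: c; apply: gen_ind => [|c d Hc' Hd'|c Hc'|_ /asboolP[n [f [Nn ->]]]].
  - by rewrite triple1 gpred1.
  - have := gpredM _ _ Hc' Hd'; by rewrite tripleM !mulg1.
  - by rewrite -gpredV tripleV !invg1 invgK.
  - have Kn : triple n^-1 1 n \in ncl (Kset N 3).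
      apply/mem_ncl/Kset3P; rewrite mulg1 mulVg !gpred1 gpredV.
      by split.
    have := ncl_normal (triple 1 1 f) Kn.
    move=> /(gpredM _ _ (etrans (gpredV _ _) Kn)).
    by rewrite tripleV tripleJ tripleM !conjg1 invgK mulgV invg1 mulg1 commgEl.
have -> : triple x y z = triple x y (x * y)^-1 * triple 1 1 (x * y * z).
  by rewrite tripleM !mulg1 mulKg.
rewrite gpredM ?Hd //; apply/mem_ncl/Kset3P.
by rewrite gpredV gpredM // mulgV gpred1.
Qed.

Section KtildeT.
Variables (G H F : groupType) (p : {hom H -> G}) (q : {hom F -> H}).
Variables (M : groupClosed H) (N : groupClosed F).
Variables (alpha : {hom H -> H}) (beta : {hom G -> G}).
Hypothesis pK : forall h, (h \in M) = (p h == 1).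
Hypothesis cM : {subset M <= center H}.
Hypothesis qS : forall h, exists f, q f = h.
Hypothesis qN : forall f, (f \in N) = (q f \in M).
Hypothesis qK : forall c, c \in der (fullg F) -> q c = 1 -> c \in relcomm N.
Hypothesis alphaAI : AI_automorphism alpha.
Hypothesis betaI : injective beta.
Hypothesis lift : forall h, p (alpha h) = beta (p h).
Hypothesis alphaM : forall m, m \in M -> alpha m = m^-1.
Local Notation TH := (Tset (fullg H)).

Lemma AI_der h : alpha h * h \in der (fullg H).
Proof.
have [_ /(_ h)] := alphaAI; rewrite /pi_ab => E.
rewrite -(ncl_id (@der_normal H)); apply/piqE.
have {E} E : piq (der (fullg H)) (alpha h) = (piq (der (fullg H)) h)^-1 by [].
by rewrite piqM E mulVg.
Qed.

Lemma AI_TH a b c : ((a, b, alpha c) \in TH) = (a * b * c \in der (fullg H)).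
Proof.
have -> : ((a, b, alpha c) \in TH)
    = ((alpha c * c)^-1 * (a * b * c) \in der (fullg H)).
  rewrite TH_mem; have dJ x y : (x ^ y \in der (fullg H)) = (x \in der (fullg H)).
    by apply/idP/idP => /der_normal H1; [have := H1 y^-1; rewrite conjgK|].
  by rewrite -[RHS](dJ _ c^-1) conjgE invgM invgK !mulgA mulgK mulgV mul1g.
by rewrite gpredMl // gpredV AI_der.
Qed.

Lemma center_prodM a b c a' b' c' : a' \in M -> b' \in M ->
  a * a' * (b * b') * (c * c') = a * b * c * (a' * b' * c').
Proof.
move=> Ma Mb; have C u v : u \in M -> u * v = v * u by move/cM/centerC.
rewrite -!mulgA; congr (a * _); rewrite (mulgA a') (C a' b) // -!mulgA.
congr (b * _); rewrite (mulgA b') (C b' c) // -!mulgA (mulgA a') (C a' c) //.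
by rewrite -!mulgA.
Qed.

Lemma ncl_Kset_ker x y z : triple x y z \in ncl (Kset N 3) ->
  [/\ x \in N, y \in N, z \in N & q (x * y * z) = 1].
Proof.
pose P (u : {ffun 'I_3 -> F}) := forall x y z, u = triple x y z ->
  [/\ x \in N, y \in N, z \in N & q (x * y * z) = 1].
suff: forall u, u \in ncl (Kset N 3) -> P u by move=> H1 /H1; exact.
have PT a b c : [/\ a \in N, b \in N, c \in N & q (a * b * c) = 1] ->
    P (triple a b c).
  move=> Habc x' y' z' E; have [E1 E2 E3] := triple_eval a b c.
  by have [] := triple_eval x' y' z'; rewrite -E E1 E2 E3 => <- <- <-.
have C u v : u \in M -> u * v = v * u by move/cM/centerC.
apply: ncl_ind => [|u v|u|u v|u].
- by rewrite -triple1; apply: PT; rewrite !mulg1 gmulf1 gpred1.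
- have [a [b [c ->]]] := tripleE u; have [a' [b' [c' ->]]] := tripleE v.
  move=> /(_ _ _ _ erefl)[Na Nb Nc E] /(_ _ _ _ erefl)[Na' Nb' Nc' E'].
  rewrite tripleM; apply: PT; rewrite !gpredM //; split=> //.
  move: E E'; rewrite !gmulfM center_prodM -?qN // => -> ->.
  by rewrite mulg1.
- have [a [b [c ->]]] := tripleE u; move=> /(_ _ _ _ erefl)[Na Nb Nc E].
  rewrite tripleV; apply: PT; rewrite !gpredV; split=> //.
  have := center_prodM (q a) (q b) (q c) (a' := q a^-1) (b' := q b^-1) (q c^-1).
  rewrite -!qN !gpredV => /(_ Na Nb); rewrite -!gmulfM !mulgV !mulg1 gmulf1.
  by rewrite gmulfM E mul1g => <-.
- have [a [b [c ->]]] := tripleE u; have [a' [b' [c' ->]]] := tripleE v.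
  move=> /(_ _ _ _ erefl)[Na Nb Nc E]; rewrite tripleJ; apply: PT.
  have J f g : f \in N -> q (f ^ g) = q f.
    by rewrite qN gmulfJ conjgE => Mf; rewrite (C _ (q g)) // mulKg.
  have -> : q (a ^ a' * b ^ b' * c ^ c') = 1.
    rewrite (gmulfM (a ^ a' * b ^ b')) (gmulfM (a ^ a')) !J //.
    by rewrite -!gmulfM.
  by rewrite !qN !J // -!qN.
- have [a [b [c ->]]] := tripleE u; move=> /Kset3P[Na Nb Nc E].
  apply: PT; split=> //; apply: morph_der1 E => f g; rewrite !qN => Mf Mg.
  exact: C.
Qed.

(** The map (x, y, z) |-> (x, y, alpha(z)), read through F -> H: since [alpha]
    inverts H/H' and [M], it turns the condition xyz in H' into the one defining
    T(H), and the condition xyz = 1 in [M] into the one defining T(M). *)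
Lemma Ktilde_isog_T : isog (Ktilde N 3) (TquotT M).
Proof.
pose S : groupClosed {ffun 'I_3 -> F} := Kset (fullg F) 3.
pose g0 (u : {ffun 'I_3 -> F}) :=
  (q (u (inord 0)), q (u (inord 1)), alpha (q (u (inord 2)))).
have g0E x y z : g0 (triple x y z) = (q x, q y, alpha (q z)).
  by rewrite /g0; have [-> -> ->] := triple_eval x y z.
have ST x y z : (triple x y z \in S) <-> (x * y * z \in der (fullg F)).
  by split=> [/Kset3P[]|] // Hd; apply/Kset3P.
have g0T u : u \in S -> g0 u \in TH.
  have [x [y [z ->]]] := tripleE u => /ST Hd.
  by rewrite g0E AI_TH -!gmulfM der_hom.
pose g (u : sgroup S) : TquotT M := tq M (g0 (val u)).
have gM : {morph g : u v / u * v}.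
  move=> u v; rewrite /g -tqM ?g0T ?(valP u) ?(valP v) //; congr tq.
  by rewrite valM /g0 !ffunE !gmulfM.
apply: (@quot_isog _ _ _ (mkhom gM)) => [t|u].
  have [[[a b] k] + <-] := tq_surj t; have [alpha' alphaK alphaK'] := alphaAI.1.
  have [x <-] := qS a; have [y <-] := qS b; have [z qz] := qS (alpha' k).
  rewrite -(alphaK' k) -qz AI_TH => Hd.
  have [|c Dc qc] := @der_lift _ _ q _ _ Hd.
    move=> a'; have [f <-] := qS a'; exists f.
    by rewrite mulVg; apply/asboolP => h; exact: commute_sym (commute1 h).
  (* Correct z by an element of the kernel of q, so that the product of the
     triple becomes the element c of F'. *)
  have Su : triple x y (z * (x * y * z)^-1 * c) \in S.
    by apply/ST; rewrite !mulgA mulgV mul1g.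
  exists (exist (fun u => u \in S) _ Su).
  rewrite /= /g /= g0E; congr (tq M (_, _, alpha _)).
  by rewrite gmulfM qc -!gmulfM mulgVK.
rewrite restr_ncl; last exact: ncl_normal.
rewrite /= /g; case: u => u Su /=.
have [x [y [z Eu]]] := tripleE u; subst u.
rewrite (tq_eq1 cM (g0T _ Su)) g0E (TM_mem cM).
have zN : (z \in N) = (alpha (q z) \in M).
  rewrite qN !pK lift; apply/eqP/eqP => [->|E]; first exact: gmulf1.
  by apply: betaI; rewrite E gmulf1.
split=> [[Mx My E]|/ncl_Kset_ker[Nx Ny Nz E]].
  have Nz : z \in N by rewrite zN E gpredM.
  have Nx : x \in N by rewrite qN.
  have Ny : y \in N by rewrite qN.
  apply: relcomm_triple => //; apply: qK; first exact/ST.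
  by rewrite !gmulfM -E alphaM ?mulVg // -qN.
split; rewrite -?qN //; rewrite alphaM -?qN //; move: E; rewrite !gmulfM.
by move=> /eqP; rewrite mulg_eq1 => /eqP ->.
Qed.

End KtildeT.

(** * The isomorphisms for a Schur cover *)

Theorem theorem5p1 (R : realType) (G : finGroupType) (H : groupType)
    (M : groupClosed H) (theta : {hom quot M -> G})
    (hcover : schur_cover R theta)
    (beta : {hom G -> G}) (hbeta : AI_automorphism beta)
    (alpha : {hom H -> H}) (halpha : AI_automorphism alpha)
    (hlift : forall h : H, theta (piq M (alpha h)) = beta (theta (piq M h)))
    (hinv : forall m : H, m \in M -> alpha m = m^-1)
    (F : groupType) (N : groupClosed F) (hFN : free_presentation N G) :
  isog (Ktilde N 3) (tau G) /\ isog (Ktilde N 3) (TquotT M).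
Proof.
have [thetab MH' cM isoM] := hcover.
have [[r [b fb]] nN [iota iotab]] := hFN.
have nM : normalp M by move=> x y Mx; rewrite center_conj // cM.
pose p : {hom H -> G} := theta \o piq M.
pose pi : {hom F -> G} := iota \o piq N.
have pS : forall x, exists h, p h = x := quot_bij_surj thetab.
have pK : forall h, (h \in M) = (p h == 1) := quot_bij_ker nM thetab.
have piS : forall x, exists f, pi f = x := quot_bij_surj iotab.
have piK : forall f, (f \in N) = (pi f == 1) := quot_bij_ker nN iotab.
(* By freeness, F -> G lifts to H and to a wedge cover of G. *)
have lift (X : groupType) (g : {hom X -> G}) :
    (forall x, exists h, g h = x) -> exists f : {hom F -> X},
      forall x, g (f x) = pi x.
  move=> gS; have [y Hy] := choice (fun k => gS (pi (b k))).
  have [f [fb' _]] := fb X y; exists f => x.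
  have [h [_ hU]] := fb G (fun k => pi (b k)).
  rewrite (hU pi) // -(hU (g \o f)) // => k.
  by rewrite -[LHS]/(g (f (b k))) fb' Hy.
have [q pq] := lift H p pS.
have [C HC] := wedge_cover_lift (enum G).
have [|phi Hphi] := lift (wc_sort C) (wc_p C).
  by move=> x; apply: HC; rewrite mem_enum.
have qN f : (f \in N) = (q f \in M) by rewrite piK pK pq.
have qDM h : exists f, (q f)^-1 * h \in M.
  have [f Ef] := piS (p h); exists f.
  by rewrite pK gmulfM gmulfV pq Ef mulVg.
have qD := der_lift (fun h => let: ex_intro f Mf := qDM h in ex_intro _ f (cM _ Mf)).
(* The defect from surjectivity lies in M, hence in H' = q(F'). *)
have qS h : exists f, q f = h.
  have [f Mf] := qDM h; have [g _ Eg] := qD _ (MH' _ Mf).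
  by exists (f * g); rewrite gmulfM Eg mulVKg.
have qL x : x \in relcomm N -> q x = 1.
  move: x; apply: gen_ind => [|x y Hx Hy|x Hx|_ /asboolP[x [y [Nx ->]]]].
  - exact: gmulf1.
  - by rewrite gmulfM Hx Hy mulg1.
  - by rewrite gmulfV Hx invg1.
  - by rewrite gmulfR commgEl center_conj ?mulVg // cM -?qN.
have qK c : c \in der (fullg F) -> q c = 1 -> c \in relcomm N.
  move=> Dc qc; apply: (multiplier_kernel piS piK isoM _ qL) => //.
    move=> m Mm; have [f Df Ef] := qD m (MH' m Mm).
    by exists f; rewrite qN Ef.
  by rewrite qN qc gpred1.
have tauT : isog (tau G) (TquotT M).
  apply: (tau_isog_T pS pK cM qS qN qK (phi := phi)) => f.
  by rewrite Hphi pq.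
have KT : isog (Ktilde N 3) (TquotT M).
  apply: (Ktilde_isog_T pK cM qS qN qK halpha _ hlift hinv).
  exact: bij_inj hbeta.1.
by split=> //; exact: isog_trans KT (isog_sym tauT).
Qed.
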